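(* Let $o_\lambda$ be the character of $O(2m+1)$ corresponding to the partition $\lambda$, and let $g,h\in O(2m+1)$ have eigenvalues equal to $x_1,x_1^{-1},\ldots,x_m,x_m^{-1},\det(g)$ and $y_1,y_1^{-1},\ldots,y_m,y_m^{-1},\det(h)$, respectively. Let $0<z<1$. Then $$\sum_{\lambda} z^{|\lambda|}\, o_{\lambda}(g)\,o_{\lambda}(h) = \frac{(1-\det(gh)z)^m \det\left(\dfrac{(1+\det(gh)z)^2+z\left(\det(h)(x_i+x_i^{-1})+\det(g)(y_j+y_j^{-1})\right)}{(1-z x_i y_j)(1-z x_i^{-1} y_j)(1-z x_i y_j^{-1})(1-z x_i^{-1} y_j^{-1})}\right)_{1\le i,j\le m}}{z^{\binom{m}{2}}\prod_{i<j} \left(y_i+y_i^{-1}-(y_j+y_j^{-1})\right) \prod_{i<j} \left(x_i+x_i^{-1}-(x_j+x_j^{-1})\right)},$$ where $\lambda$ runs over all partitions of arbitrary non-negative integers with at most $m$ parts.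
   Context: Here $m\ge 1$ is an integer, and the products over $i<j$ are over $1\le i<j\le m$. $O(2m+1)$ is the compact group of real orthogonal $(2m+1)\times(2m+1)$ matrices. Every $g\in O(2m+1)$ has $\det(g)\in\{1,-1\}$ as an eigenvalue, and its remaining eigenvalues can be grouped in pairs $x_i,x_i^{-1}$. A partition with at most $m$ parts is written $\lambda=(\lambda_1\ge\cdots\ge\lambda_m\ge 0)$ with integer entries, and $|\lambda|=\sum_i\lambda_i$. The irreducible representations of $O(n)$, $n=2m+1$, are labeled by partitions $\lambda$ with $\lambda'_1+\lambda'_2\le n$, where $\lambda'_i=\#\{j:\lambda_j\ge i\}$. For $\lambda$ with at most $m$ parts (i.e. $\lambda'_1\le m$), the character $o_\lambda$ of the representation labeled by $\lambda$ is given by the Weyl character formula $$o_{\lambda}(g) = \frac{\det\left(x_{i}^{\lambda_j+m-j+\frac{1}{2}}-\det(g)\, x_{i}^{-(\lambda_j+m-j+\frac{1}{2})} \right)_{1\le i,j\le m}}{\det\left(x_{i}^{m-j+\frac{1}{2}}- \det(g)\,x_{i}^{-(m-j+\frac{1}{2})} \right)_{1\le i,j\le m}}.$$ *)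

(* Defs.v *)
From HB Require Import structures.
From mathcomp Require Import all_boot all_order all_algebra finmap.
From mathcomp Require Import all_classical all_reals all_analysis.
From mathcomp Require Import showcase.summability.
From mathcomp Require Import complex.

Set Implicit Arguments.
Unset Strict Implicit.
Unset Printing Implicit Defensive.

Import Order.TTheory GRing.Theory Num.Theory.
Import numFieldNormedType.Exports.

Local Open Scope classical_set_scope.
Local Open Scope ring_scope.

(* Typing R[i] as a numClosedFieldType gives it the topology of its norm. *)
Definition Cplx (R : realType) : numClosedFieldType := R[i].

Definition toC (R : realType) (a : R) : Cplx R := (a%:C)%C.

(* Partitions with at most m parts, as weakly decreasing m-tuples padded with
   zeros. The part l_(j+1) of the usual one-based notation is tnth (val l) j. *)
Notation partition_le m := {l : m.-tuple nat | sorted geq l}.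

Definition psize (m : nat) (l : partition_le m) : nat :=
  (\sum_(j < m) tnth (val l) j)%N.

(* Sum over a possibly infinite index type: the net of all finite partial sums
   converges (unconditional, hence absolute, convergence). *)
Definition has_sum (I : choiceType) (R : realType) (f : I -> Cplx R)
    (S : Cplx R) : Prop :=
  partial_sum f @ totally --> S.

Definition orthogonal_group (R : realType) (n : nat) : set 'M[R]_n :=
  [set g | g *m g^T = 1%:M].

(* A continuous irreducible representation of O(n) on C^d. Only the values of
   rho on O(n) matter. As usual in mathcomp, matrices act on row vectors. *)
Record orthogonal_irrep (R : realType) (n d : nat)
    (rho : 'M[R]_n -> 'M[Cplx R]_d) : Prop := OrthogonalIrrep {
  irrep_one : rho 1%:M = 1%:M;
  irrep_mul : forall g h, orthogonal_group g -> orthogonal_group h ->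
    rho (g *m h) = rho g *m rho h;
  irrep_continuous : {within @orthogonal_group R n, continuous rho};
  irrep_dim_gt0 : (0 < d)%N;
  irrep_simple : forall U : 'M[Cplx R]_d,
    (forall g, orthogonal_group g -> stablemx U (rho g)) ->
    U = 0 \/ row_full U
}.

(* The eigenvalues of g, with multiplicity, are x_i, x_i^-1 and det g. *)
Definition has_eigenvalues (R : realType) (m : nat) (g : 'M[R]_(2 * m + 1))
    (x : 'rV[Cplx R]_m) : Prop :=
  char_poly (map_mx (@toC R) g) =
    ('X - (toC (\det g))%:P) *
    \prod_(i < m) (('X - (x 0 i)%:P) * ('X - ((x 0 i)^-1)%:P)).

(* The determinants of the Weyl character formula for O(2m+1), where e is the
   determinant of the group element. The vector s lists square roots of the
   x_i, so that x_i^(k + 1/2) is s_i^(2k + 1); changing the sign of one s_i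
   changes the sign of both determinants. *)
Definition weyl_det (R : realType) (m : nat) (a : 'I_m -> nat) (e : Cplx R)
    (s : 'rV[Cplx R]_m) : Cplx R :=
  \det (\matrix_(i < m, j < m)
    let k := (2 * (a j + (m - j.+1)) + 1)%N in
    (s 0 i ^+ k - e * s 0 i ^- k)).

Definition weyl_num (R : realType) (m : nat) (l : partition_le m) (e : Cplx R)
    (s : 'rV[Cplx R]_m) : Cplx R :=
  weyl_det (fun j => tnth (val l) j) e s.

Definition weyl_den (R : realType) (m : nat) (e : Cplx R)
    (s : 'rV[Cplx R]_m) : Cplx R :=
  weyl_det (fun=> 0%N) e s.

(* o is the character of the irreducible representation of O(2m+1) labeled by
   l. The label is read off from the Weyl character formula at the elements
   where its denominator does not vanish; these are dense in O(2m+1), so by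
   continuity the formula determines the whole character. *)
Definition is_orthogonal_character (R : realType) (m : nat)
    (l : partition_le m) (o : 'M[R]_(2 * m + 1) -> Cplx R) : Prop :=
  exists (d : nat) (rho : 'M[R]_(2 * m + 1) -> 'M[Cplx R]_d),
    [/\ orthogonal_irrep rho,
        forall g, orthogonal_group g -> o g = \tr (rho g) &
        forall g (s : 'rV[Cplx R]_m), orthogonal_group g ->
          has_eigenvalues g (\row_i s 0 i ^+ 2) ->
          weyl_den (toC (\det g)) s != 0 ->
          o g = weyl_num l (toC (\det g)) s / weyl_den (toC (\det g)) s].

Definition cauchy_rhs (R : realType) (m : nat) (z dg dh dgh : Cplx R)
    (x y : 'rV[Cplx R]_m) : Cplx R :=
  ((1 - dgh * z) ^+ m *
   \det (\matrix_(i < m, j < m)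
     (((1 + dgh * z) ^+ 2
        + z * (dh * (x 0 i + (x 0 i)^-1) + dg * (y 0 j + (y 0 j)^-1)))
      / ((1 - z * x 0 i * y 0 j) * (1 - z * (x 0 i)^-1 * y 0 j)
         * (1 - z * x 0 i * (y 0 j)^-1) * (1 - z * (x 0 i)^-1 * (y 0 j)^-1)))))
  / (z ^+ 'C(m, 2)
     * (\prod_(i < m) \prod_(j < m | (i < j)%N)
          (y 0 i + (y 0 i)^-1 - (y 0 j + (y 0 j)^-1)))
     * (\prod_(i < m) \prod_(j < m | (i < j)%N)
          (x 0 i + (x 0 i)^-1 - (x 0 j + (x 0 j)^-1)))).

Definition regular (R : realType) (m : nat) (x : 'rV[Cplx R]_m) : Prop :=
  forall i j : 'I_m, (i < j)%N ->
    x 0 i + (x 0 i)^-1 != x 0 j + (x 0 j)^-1.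

(* Pairs of vectors on the unit torus (where the eigenvalues of orthogonal
   matrices lie) at which the denominator of cauchy_rhs does not vanish. *)
Definition regular_pairs (R : realType) (m : nat) :
    set ('rV[Cplx R]_m * 'rV[Cplx R]_m) :=
  [set p : 'rV[Cplx R]_m * 'rV[Cplx R]_m |
    [/\ forall i, `|p.1 0 i| = 1, forall i, `|p.2 0 i| = 1,
        regular p.1 & regular p.2]].

(* Main.v *)
Require Import Defs.
From HB Require Import structures.
From mathcomp Require Import all_boot all_order all_algebra finmap.
From mathcomp Require Import all_classical all_reals all_analysis.
From mathcomp Require Import showcase.summability.
From mathcomp Require Import complex.
From mathcomp Require Import perm ring lra zify.

Set Implicit Arguments.
Unset Strict Implicit.
Unset Printing Implicit Defensive.

Import Order.TTheory GRing.Theory Num.Theory.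
Import numFieldNormedType.Exports.

Local Open Scope classical_set_scope.
Local Open Scope ring_scope.

(** Put u_i = x_i + 1/x_i and v_j = y_j + 1/y_j. Dividing the row of x_i in the
    Weyl determinants by s - e/s, with s^2 = x_i and e = det g, turns the entry of
    exponent a + 1/2 into the coefficient of t^a in (1 + e t) / (1 - u_i t + t^2).
    Cauchy-Binet, applied to the products of these coefficients for g and h,
    expresses the sum over the partitions with l_1 + m - 1 < M as a determinant of
    partial sums of a rational power series in z, whose limit is the entry of the
    right-hand side, divided by the two Vandermonde products.

    To reach elements where the quotients are 0/0, the coefficients are replaced
    by their Newton divided differences in u_0, ..., u_i, which cancels the
    Vandermonde product and leaves a continuous function on the torus. It gives
    the character at every g, since g lies in a torus of O(2m+1) along which it can
    be moved to elements with nonzero Weyl denominator. The divided differences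
    grow slower than any exponential uniformly on the torus, so the sums converge
    uniformly there and the right-hand side extends continuously. *)

(** * Newton interpolation of Chebyshev quotients *)

Section ChebyshevQuotient.
Variable C : comNzRingType.
Implicit Types (u w e : C) (f : nat -> C) (v : nat -> C).

(* The coefficients of the power series f(t) / (1 - u t + t^2). *)
Fixpoint chebquo u f n : C :=
  if n is n1.+1 then
    if n1 is n2.+1 then u * chebquo u f n1 - chebquo u f n2 + f n1.+1
    else u * f 0%N + f 1%N
  else f 0%N.

Definition shift f n : C := if n is n1.+1 then f n1 else 0.

Lemma chebquoSS u f n :
  chebquo u f n.+2 = u * chebquo u f n.+1 - chebquo u f n + f n.+2.
Proof. by []. Qed.

(** In generating functions: 1/(1 - w t + t^2) - 1/(1 - u t + t^2) = (w - u) t / ((1 - w t + t^2)(1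
    - u t + t^2)), and [shift] is multiplication by t. *)
Lemma chebquo_diff w u f n :
  chebquo w f n = chebquo u f n + (w - u) * chebquo w (shift (chebquo u f)) n.
Proof.
elim/ltn_ind: n => -[|[|n]] IH.
- by rewrite /= mulr0 addr0.
- by rewrite /=; ring.
rewrite !chebquoSS -[shift _ n.+2]/(chebquo u f n.+1) (IH n.+1) ?(IH n) //.
by ring.
Qed.

(** The coefficients of t^k f(t) / ((1 - v_0 t + t^2) ... (1 - v_(k-1) t + t^2)). Nothing is divided
    by differences of nodes, so nodes may coincide. *)
Fixpoint newton_rem f v k : nat -> C :=
  if k is k1.+1 then shift (chebquo (v k1) (newton_rem f v k1)) else f.

(* The divided difference at v 0, ..., v k of u |-> chebquo u f n. *)
Definition divdiff f v k n : C := chebquo (v k) (newton_rem f v k) n.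

Lemma newton_interpolation f v w n i :
  chebquo w f n = \sum_(k < i) (\prod_(l < k) (w - v l)) * divdiff f v k n
    + (\prod_(l < i) (w - v l)) * chebquo w (newton_rem f v i) n.
Proof.
elim: i => [|i IH]; first by rewrite !big_ord0; ring.
rewrite IH !big_ord_recr /= (chebquo_diff w (v i) (newton_rem f v i)).
by rewrite /divdiff; ring.
Qed.

Lemma chebquo_divdiff f v n m (i : 'I_m) :
  chebquo (v i) f n =
  \sum_(k < m) (if (k <= i)%N then \prod_(l < k) (v i - v l) else 0)
     * divdiff f v k n.
Proof.
(* With [i.+1] terms the remainder contains the factor [v i - v i]. *)
rewrite (newton_interpolation f v (v i) n i.+1).
rewrite [X in _ + X * _]big_ord_recr /= subrr mulr0 mul0r addr0.
rewrite (big_ord_widen _ (fun k => (\prod_(l < k) (v i - v l)) * divdiff f v k n)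
  (ltn_ord i)) big_mkcond /=.
by apply: eq_bigr => k _; rewrite ltnS; case: ifP; rewrite ?mul0r.
Qed.

(** Newton's formula factors the matrix through a lower triangular one, whose diagonal multiplies to
    the Vandermonde product. *)
Lemma det_chebquo f v m (a : 'I_m -> nat) :
  \det (\matrix_(i < m, j < m) chebquo (v i) f (a j)) =
  (\prod_(i < m) \prod_(l < i) (v i - v l))
    * \det (\matrix_(i < m, j < m) divdiff f v i (a j)).
Proof.
pose N := \matrix_(i < m, k < m)
  (if (k <= i)%N then \prod_(l < k) (v i - v l) else 0).
have -> : \matrix_(i < m, j < m) chebquo (v i) f (a j) =
    N *m \matrix_(i < m, j < m) divdiff f v i (a j).
  apply/matrixP => i j; rewrite !mxE (chebquo_divdiff _ _ _ i).
  by apply: eq_bigr => k _; rewrite !mxE.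
rewrite det_mulmx det_trig; last first.
  by apply/is_trig_mxP => i k ik; rewrite mxE leqNgt ik.
by congr (_ * _); apply: eq_bigr => i _; rewrite mxE leqnn.
Qed.

(** The generating function of [newton_rem f v k] is divisible by t^k. *)
Lemma newton_rem_small f v k n : (n < k)%N -> newton_rem f v k n = 0.
Proof.
elim: k n => // k IH [|n] //= nk.
have : forall j, (j <= n)%N ->
    chebquo (v k) (newton_rem f v k) j = 0; last exact.
elim/ltn_ind => -[|[|j]] IHj jn.
- by rewrite /= IH //; lia.
- by rewrite /= !IH ?mulr0 ?addr0 //; lia.
rewrite chebquoSS (IHj j.+1) ?(IHj j) //; try by lia.
by rewrite IH ?mulr0 ?subr0 ?addr0 //; lia.
Qed.

Lemma divdiff_small f v k n : (n < k)%N -> divdiff f v k n = 0.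
Proof.
move=> nk; have := newton_rem_small f v (k := k.+1) (n := n.+1).
by move=> /(_ nk).
Qed.

Lemma divdiff_diag f v k : f 0%N = 1 -> divdiff f v k k = 1.
Proof.
move=> f0; have aux j : newton_rem f v j j = 1 -> divdiff f v j j = 1.
  rewrite /divdiff; case: j => [|[|j]] // Hj.
    by rewrite [chebquo _ _ 1]/= mulr0 add0r; move: Hj.
  rewrite chebquoSS Hj -[chebquo _ _ j.+1]/(divdiff f v j.+2 j.+1).
  rewrite -[chebquo _ _ j]/(divdiff f v j.+2 j) !divdiff_small //.
  by rewrite mulr0 subr0 add0r.
by elim: k => [|k IH]; apply: aux => //; exact: IH.
Qed.

Definition reversal_sign m : C := (-1) ^+ perm (@rev_ord_inj m).

Lemma reversal_sign_sqr m : reversal_sign m * reversal_sign m = 1.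
Proof. by rewrite /reversal_sign -signr_addb addbb. Qed.

(** Reversing the columns leaves an upper triangular matrix with unit diagonal. This determinant is
    what remains of the Weyl denominator after cancellation. *)
Lemma det_divdiff_rev f v m : f 0%N = 1 ->
  \det (\matrix_(i < m, j < m) divdiff f v i (m - j.+1)) = reversal_sign m.
Proof.
move=> f0; set A := \matrix_(i < m, j < m) divdiff f v i j.
have -> : \matrix_(i < m, j < m) divdiff f v i (m - j.+1) =
    col_perm (perm (@rev_ord_inj m)) A.
  by apply/matrixP => i j; rewrite !mxE permE.
rewrite col_permE det_mulmx det_perm odd_permV -[RHS]mul1r; congr (_ * _).
rewrite -det_tr det_trig.
  by apply: big1 => i _; rewrite !mxE divdiff_diag.
by apply/is_trig_mxP => i j ij; rewrite !mxE divdiff_small.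
Qed.

End ChebyshevQuotient.

(** * Weyl quotients in rank one and their bilinear generating function *)

Section OrthogonalPolynomials.
Variable C : idomainType.
Implicit Types (u v e d z : C).

Definition weyl_series e n : C :=
  match n with 0%N => 1 | 1%N => e | _ => 0 end.

(* The characters of O(3): with u = x + x^-1, weyl_poly 1 u n is the sum of the
   x^k with -n <= k <= n. *)
Definition weyl_poly e u n : C := chebquo u (weyl_series e) n.

Lemma weyl_poly0 e u : weyl_poly e u 0 = 1. Proof. by []. Qed.

Lemma weyl_poly1 e u : weyl_poly e u 1 = u + e.
Proof. by rewrite /weyl_poly /= mulr1. Qed.

Lemma weyl_polySS e u n :
  weyl_poly e u n.+2 = u * weyl_poly e u n.+1 - weyl_poly e u n.
Proof. by rewrite /weyl_poly chebquoSS addr0. Qed.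

(** For u = x + x^-1 and v = y + y^-1, the product of the four denominators of the theorem; see
    [kernel_denE]. *)
Definition kernel_den z u v : C :=
  (1 + z ^+ 2) ^+ 2 - z * (1 + z ^+ 2) * (u * v)
  + z ^+ 2 * (u ^+ 2 + v ^+ 2 - 4%:R).

(** Each row of the determinant absorbs one of the m factors [1 - e * d * z] that precede it in the
    theorem. *)
Definition kernel_num z e d u v : C :=
  (1 - e * d * z) * ((1 + e * d * z) ^+ 2 + z * (d * u + e * v)).

(* The sequence c satisfies the linear recurrence whose reversed
   characteristic polynomial is kernel_den, so the product telescopes. *)
Lemma kernel_partial_sum z e d u v N : e * e = 1 -> d * d = 1 ->
  let c n := weyl_poly e u n * weyl_poly d v n in
  kernel_den z u v * (\sum_(n < N) z ^+ n * c n) =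
  kernel_num z e d u v
  - z ^+ N * (c N + z * (c N.+1 - u * v * c N)
      + z ^+ 2 * (c N.+2 - u * v * c N.+1 + (u ^+ 2 + v ^+ 2 - 2%:R) * c N)
      + z ^+ 3 * (c N.+3 - u * v * c N.+2
           + (u ^+ 2 + v ^+ 2 - 2%:R) * c N.+1 - u * v * c N)).
Proof.
have sqr1 x : x * x = 1 -> x = 1 \/ x = -1 :> C.
  by move=> /eqP; rewrite -expr2 sqrf_eq1 => /orP[] /eqP; [left | right].
move=> ee dd c; rewrite /c {c}; elim: N => [|N IH].
  rewrite big_ord0 mulr0 !weyl_polySS !weyl_poly1 !weyl_poly0 /kernel_num.
  (* The base case holds only modulo e^2 = d^2 = 1, so it is checked for each choice of signs. *)
  by case: (sqr1 e ee) => ->; case: (sqr1 d dd) => ->; ring.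
rewrite big_ord_recr /= mulrDr IH !weyl_polySS /kernel_den (exprS z N).
by ring.
Qed.

End OrthogonalPolynomials.

(** Both sides satisfy w(n+2) = u w(n+1) - w(n) with u = s^2 + s^-2, so only n = 0 and n = 1 need a
    computation. *)
Lemma weyl_poly_ratio (F : fieldType) (e s : F) n : s != 0 -> e * e = 1 ->
  s ^+ (2 * n + 1) - e * s ^- (2 * n + 1) =
  (s - e * s^-1) * weyl_poly e (s ^+ 2 + (s ^+ 2)^-1) n.
Proof.
move=> s0 ee; elim/ltn_ind: n => -[|[|n]] IH.
- by rewrite weyl_poly0 mulr1.
- rewrite weyl_poly1; have ee' : e ^+ 2 = 1 by [].
  apply/eqP; rewrite -subr_eq0; apply/eqP.
  transitivity ((e ^+ 2 - 1) * s^-1); last by rewrite ee' subrr mul0r.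
  by field.
rewrite weyl_polySS mulrBr mulrCA -IH // -IH //.
rewrite (_ : 2 * n.+2 + 1 = (2 * n + 1).+4)%N; last by lia.
rewrite (_ : 2 * n.+1 + 1 = (2 * n + 1).+2)%N; last by lia.
rewrite -!exprVn !exprS !expr0; by field.
Qed.

(** * The Cauchy-Binet formula *)

Section CauchyBinet.
Variables (C : comNzRingType) (m M : nat).
Implicit Types (t g : m.-tuple 'I_M) (A : 'M[C]_(m, M)) (B : 'M[C]_(M, m)).

Definition decreasing t : bool := sorted (fun i j : 'I_M => (j < i)%N) t.

(** Multilinearity in the rows: [tnth t i] is the row of [B] selected when row i of [A *m B] is
    expanded. *)
Lemma det_mulmx_tuple A B :
  \det (A *m B) = \sum_t (\prod_i A i (tnth t i)) *
                   \det (\matrix_(i < m, j < m) B (tnth t i) j).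
Proof.
rewrite /determinant.
under eq_bigr => s _.
  under eq_bigr => i _ do rewrite mxE.
  rewrite bigA_distr_bigA mulr_sumr /=.
  over.
rewrite exchange_big /=.
rewrite (reindex (fun t : m.-tuple 'I_M => [ffun i => tnth t i])) /=; last first.
  exists (fun f : {ffun 'I_m -> 'I_M} => [tuple f i | i < m]) => [t|f] _.
    by apply: eq_from_tnth => i; rewrite tnth_mktuple ffunE.
  by apply/ffunP => i; rewrite ffunE tnth_mktuple.
apply: eq_bigr => t _; rewrite mulr_sumr; apply: eq_bigr => s _.
rewrite big_split /= mulrCA; congr (_ * (_ * _)).
  by apply: eq_bigr => i _; rewrite ffunE.
by apply: eq_bigr => i _; rewrite mxE ffunE.
Qed.

Lemma decreasing_uniq g : decreasing g -> uniq g.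
Proof.
apply: sorted_uniq => [a b c /= ba cb|a /=]; last by rewrite ltnn.
exact: ltn_trans cb ba.
Qed.

Let sort_dec t : m.-tuple 'I_M := sort_tuple (fun i j : 'I_M => (j <= i)%N) t.

Let sort_dec_perm t : perm_eq (sort_dec t) t.
Proof. by rewrite /= perm_sort. Qed.

Let sort_decP t : uniq t -> decreasing (sort_dec t).
Proof.
move=> ut; rewrite /decreasing.
have -> : sorted (fun i j : 'I_M => (j < i)%N) (sort_dec t) =
   sorted gtn (map val (sort_dec t)) by rewrite sorted_map.
rewrite gtn_sorted_uniq_geq map_inj_uniq; last exact: val_inj.
rewrite (perm_uniq (sort_dec_perm t)) ut /= sorted_map.
by apply: sort_sorted => a b; apply: leq_total.
Qed.

Let sort_dec_id g t : decreasing g -> perm_eq g t -> sort_dec t = g.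
Proof.
move=> dg pgt; apply: val_inj => /=.
have st : decreasing (sort_dec t).
  by apply: sort_decP; rewrite -(perm_uniq pgt) decreasing_uniq.
apply: sorted_eq st dg _.
- by move=> a b c /= ba cb; apply: ltn_trans cb ba.
- by move=> a b /= /andP[h1 h2]; have := ltn_trans h1 h2; rewrite ltnn.
- by rewrite (permPl (sort_dec_perm t)) perm_sym.
Qed.

(** In [det_mulmx_tuple] a tuple with a repeated entry contributes zero. The others are grouped by
    their decreasing rearrangement [g], and the sum over the rearrangements of [g] rebuilds the
    minor of [A]. *)
Lemma cauchy_binet A B :
  \det (A *m B) = \sum_(g | decreasing g)
    \det (\matrix_(i < m, j < m) A i (tnth g j)) *
    \det (\matrix_(i < m, j < m) B (tnth g i) j).
Proof.
rewrite det_mulmx_tuple (bigID (fun t => uniq t)) /=.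
rewrite [X in _ + X]big1 ?addr0; last first.
  move=> t nut; rewrite (_ : \det _ = 0) ?mulr0 //.
  have /tuple_uniqP : ~~ uniq t by [].
  move=> /injectiveP/injectivePn [i [j ij e]].
  by apply: (determinant_alternate ij) => k; rewrite !mxE e.
rewrite (partition_big sort_dec decreasing) /=; last exact: sort_decP.
apply: eq_bigr => g dg; have ug := decreasing_uniq dg.
pose perm_of (s : 'S_m) := [tuple tnth g (s i) | i < m].
have injg : injective (tnth g) by apply/tuple_uniqP.
have injp : injective perm_of.
  move=> s s' /(congr1 (fun t => tnth t)) e; apply/permP => i; apply: injg.
  by have := congr1 (fun f => f i) e; rewrite !tnth_mktuple.
(* The rearrangements of [g] are indexed by permutations; on them the default [1%g] is never
   taken. *)
rewrite (reindex_onto perm_of (fun t => odflt 1%g [pick s | t == perm_of s])) /=;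
  last first.
  move=> t /andP[ut /eqP gt]; case: pickP => [s /eqP -> //|].
  have /tuple_permP[s /val_inj es] : perm_eq t g.
    by rewrite -gt perm_sym sort_dec_perm.
  by move/(_ s); rewrite es eqxx.
rewrite big_mkcond /= {1}/determinant mulr_suml; apply: eq_bigr => s _.
have pg : perm_eq (perm_of s) g by apply/tuple_permP; exists s.
rewrite (perm_uniq pg) ug /= (sort_dec_id dg) 1?perm_sym // eqxx /=.
have -> : odflt 1%g [pick s0 | perm_of s == perm_of s0] == s.
  by case: pickP => [s' /eqP/injp -> //|/(_ s)]; rewrite eqxx.
rewrite -mulrA mulrCA; congr (_ * _).
  by apply: eq_bigr => i _; rewrite mxE tnth_mktuple.
rewrite -det_perm -det_mulmx -row_permE; congr (\det _).
by apply/matrixP => i j; rewrite !mxE tnth_mktuple.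
Qed.

End CauchyBinet.

(** The power z^k is attached to column k of the first factor, so each of its minors releases a
    monomial in z. *)
Lemma cauchy_binet_series (C : comNzRingType) m M (z : C)
    (a b : 'I_m -> nat -> C) :
  \det (\matrix_(i < m, j < m) \sum_(k < M) z ^+ k * (a i k * b j k)) =
  \sum_(g : m.-tuple 'I_M | decreasing g) z ^+ (\sum_(j < m) tnth g j)%N *
    (\det (\matrix_(i < m, j < m) a i (tnth g j)) *
     \det (\matrix_(i < m, j < m) b i (tnth g j))).
Proof.
pose A := \matrix_(i < m, k < M) (z ^+ k * a i k).
pose B := \matrix_(k < M, j < m) b j k.
rewrite (_ : \matrix_(i, j) _ = A *m B); last first.
  by apply/matrixP => i j; rewrite !mxE; apply: eq_bigr => k _; rewrite !mxE mulrA.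
rewrite cauchy_binet; apply: eq_bigr => g _.
rewrite -det_tr (_ : _^T = diag_mx (\row_j z ^+ tnth g j) *m
    (\matrix_(i < m, j < m) a i (tnth g j))^T); last first.
  by apply/matrixP => i j; rewrite mul_diag_mx !mxE.
rewrite det_mulmx det_diag det_tr -mulrA; congr (_ * _).
  by rewrite -prodrXr; apply: eq_bigr => j _; rewrite mxE.
congr (_ * _); rewrite -[RHS]det_tr; congr (\det _).
by apply/matrixP => i j; rewrite !mxE.
Qed.

(** * Partitions as strictly decreasing tuples *)

Section Partitions.
Variable m : nat.
Implicit Types (l : partition_le m).

(** Adding the staircase (m-1, ..., 0) makes the parts strictly decreasing and gives the exponents
    of the Weyl determinant less 1/2. *)
Definition shifted_part l (j : 'I_m) : nat := (tnth (val l) j + (m - j.+1))%N.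

Lemma sum_rev_ord : (\sum_(j < m) (m - j.+1) = 'C(m, 2))%N.
Proof.
rewrite -bin2_sum big_mkord (reindex_inj rev_ord_inj) /=.
by apply: eq_bigr => j _; have := ltn_ord j; lia.
Qed.

Lemma sum_shifted_part l :
  (\sum_(j < m) shifted_part l j = psize l + 'C(m, 2))%N.
Proof. by rewrite big_split /= sum_rev_ord. Qed.

Fact sorted_nseq0 : sorted geq (nseq_tuple m 0%N).
Proof. by case: m => //= n; elim: n. Qed.

(** The zero partition is a default for unsorted results, which do not arise from decreasing [g]. *)
Definition partition_of M (g : m.-tuple 'I_M) : partition_le m :=
  insubd (exist _ (nseq_tuple m 0%N) sorted_nseq0)
    [tuple (tnth g j - (m - j.+1))%N | j < m].

(** Gaps of at least one between neighbours add up. Hence removing the staircase leaves a weakly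
    decreasing tuple and never truncates a subtraction. *)
Lemma decreasing_ltn M (g : m.-tuple 'I_M) (i j : 'I_m) :
  decreasing g -> (i < j)%N -> (tnth g j + (j - i) <= tnth g i)%N.
Proof.
move=> dg; move dk: (j - i)%N => k; elim: k j dk => [|k IH] j dk ij; first lia.
have jm := ltn_ord j; have j'm : (j.-1 < m)%N by lia.
have x0 := tnth g i.
have step : (tnth g j < tnth g (Ordinal j'm))%N.
  rewrite !(tnth_nth x0) /=.
  have := (sortedP x0 dg) j.-1; rewrite size_tuple.
  have -> : j.-1.+1 = j by lia.
  by apply; lia.
have [e|ne] := eqVneq i (Ordinal j'm).
  by rewrite e; rewrite e /= in dk ij; lia.
have lt' : (i < j.-1)%N.
  by move: ne; rewrite -val_eqE /=; lia.
have := IH (Ordinal j'm) _ lt'; rewrite /= => /(_ _); lia.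
Qed.

Lemma decreasing_geq M (g : m.-tuple 'I_M) (j : 'I_m) :
  decreasing g -> (m - j.+1 <= tnth g j)%N.
Proof.
move=> dg; have jm := ltn_ord j.
have h : (m.-1 < m)%N by lia.
have [e|ne] := eqVneq j (Ordinal h); first by rewrite e /=; lia.
have lt : (j < Ordinal h)%N by move: ne; rewrite -val_eqE /=; lia.
by have := decreasing_ltn dg lt; rewrite /=; lia.
Qed.

Lemma shifted_partition_of M (g : m.-tuple 'I_M) j :
  decreasing g -> shifted_part (partition_of g) j = tnth g j.
Proof.
move=> dg; rewrite /shifted_part /partition_of insubdK.
  by rewrite tnth_mktuple subnK // decreasing_geq.
rewrite unfold_in; apply/(sortedP 0%N) => i; rewrite size_tuple => im.
have im' : (i < m)%N by lia.
have -> : i = Ordinal im' by []. have -> : (Ordinal im').+1 = Ordinal im by [].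
rewrite -!tnth_nth !tnth_mktuple /geq /=.
have := @decreasing_ltn M g (Ordinal im') (Ordinal im) dg (ltnSn _).
by rewrite /=; lia.
Qed.

Lemma shifted_part_inj l l' :
  shifted_part l =1 shifted_part l' -> l = l'.
Proof.
move=> e; apply: val_inj; apply: eq_from_tnth => j.
by have := e j; rewrite /shifted_part; lia.
Qed.

Lemma psize_partition_of M (g : m.-tuple 'I_M) : decreasing g ->
  (\sum_(j < m) tnth g j = psize (partition_of g) + 'C(m, 2))%N.
Proof.
by move=> dg; rewrite -sum_shifted_part; apply: eq_bigr => j _;
  rewrite shifted_partition_of.
Qed.

Lemma shifted_part_decr l (i j : 'I_m) : (i < j)%N ->
  (shifted_part l j < shifted_part l i)%N.
Proof.
move=> ij; have := ltn_ord j; rewrite /shifted_part.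
suff : (tnth (val l) j <= tnth (val l) i)%N by lia.
rewrite !(tnth_nth 0%N); apply: (sorted_leq_nth _ _ _ (valP l)) => //.
- by move=> a b c /= ba cb; apply: leq_trans cb ba.
- by move=> a /=.
- by rewrite inE size_tuple.
- by rewrite inE size_tuple.
- exact: ltnW.
Qed.

(** The partitions with all shifted parts below [M], which are those met by the Cauchy-Binet sum
    over [M] columns. *)
Definition partitions_below M : {fset partition_le m} :=
  [fset l in [seq partition_of g | g <- enum (@decreasing m M)]]%fset.

Lemma partitions_belowP M l :
  (forall j, shifted_part l j < M)%N -> l \in partitions_below M.
Proof.
move=> lM; rewrite inE /=; pose g := [tuple Ordinal (lM j) | j < m].
have dg : decreasing g.
  case: (posnP m) => [m0|m_gt0].
    by rewrite /decreasing (size0nil (s := g)) // size_tuple m0.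
  apply/(sortedP (Ordinal (lM (Ordinal m_gt0)))) => i; rewrite size_tuple => im.
  have im' : (i < m)%N by lia.
  have e : i = Ordinal im' :> nat by [].
  rewrite {1 2}e -[(Ordinal im').+1]/(nat_of_ord (Ordinal im)).
  by rewrite -!tnth_nth !tnth_mktuple /= shifted_part_decr.
apply/mapP; exists g; first by rewrite mem_enum.
by apply: shifted_part_inj => j; rewrite shifted_partition_of // tnth_mktuple.
Qed.

Lemma partial_sum_below (V : zmodType) M (F : partition_le m -> V) :
  partial_sum F (partitions_below M) =
  \sum_(g : m.-tuple 'I_M | decreasing g) F (partition_of g).
Proof.
rewrite /partial_sum -(big_seq_fsetE _ _ predT F) /=.
rewrite -[RHS]big_enum /= -(big_map (@partition_of M) predT F).
apply: perm_big; apply: uniq_perm; first exact: fset_uniq.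
  rewrite map_inj_in_uniq ?enum_uniq // => g g'.
  rewrite !mem_enum => dg dg' e; apply: eq_from_tnth => j; apply: val_inj.
  by rewrite /= -!shifted_partition_of // e.
by move=> l; rewrite inE.
Qed.

(** Dropping the order condition on the parts only enlarges the sum, which becomes a product of m
    geometric sums. *)
Lemma sum_psize_le (K : numFieldType) (q : K) (J : {fset partition_le m}) :
  0 <= q -> q < 1 -> \sum_(l : J) q ^+ psize (val l) <= (1 - q)^-1 ^+ m.
Proof.
move=> q0 q1.
have [M JM] : exists M, forall l, l \in J -> forall j, (tnth (val l) j < M.+1)%N.
  exists (\max_(l : J) \max_j tnth (val (val l)) j) => l lJ j; rewrite ltnS.
  apply: leq_trans (leq_bigmax (F := fun l : J => \max_j tnth (val (val l)) j)
     [` lJ]%fset) => /=.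
  exact: (leq_bigmax (F := tnth (val l))).
have geo : \sum_(k < M.+1) q ^+ k <= (1 - q)^-1.
  rewrite -[leRHS]mul1r ler_pdivlMr ?subr_gt0 // mulrC -opprB mulNr -subrX1.
  by rewrite opprB lerBlDr lerDl exprn_ge0.
pose phi (l : partition_le m) : {ffun 'I_m -> 'I_M.+1} :=
  [ffun j => inord (tnth (val l) j)].
apply: (@le_trans _ _ (\prod_(j < m) \sum_(k < M.+1) q ^+ k)); last first.
  rewrite prodr_const card_ord; apply: lerXn2r => //.
    by rewrite nnegrE sumr_ge0 // => k _; rewrite exprn_ge0.
  by rewrite nnegrE invr_ge0 subr_ge0 ltW.
rewrite bigA_distr_bigA /=.
have phiE l j : l \in J -> phi l j = tnth (val l) j :> nat.
  by move=> lJ; rewrite ffunE inordK // JM.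
pose r := [seq phi (val l) | l : J].
have ur : uniq r.
  rewrite map_inj_uniq ?enum_uniq // => -[l lJ] [l' lJ'] e.
  apply: val_inj; apply: val_inj; apply: eq_from_tnth => j /=.
  by rewrite -!phiE // -[l]/(val [` lJ]%fset) e.
have -> : \sum_(l : J) q ^+ psize (val l) =
    \sum_(f <- r) \prod_(j < m) q ^+ f j.
  rewrite big_map big_enum /=; apply: eq_bigr => -[l lJ] _ /=.
  rewrite prodrXr; congr (_ ^+ _); apply: eq_bigr => j _.
  by rewrite phiE.
rewrite big_uniq //= [leRHS](bigID (mem r)) /= lerDl.
by apply: sumr_ge0 => f _; apply: prodr_ge0 => j _; rewrite exprn_ge0.
Qed.

End Partitions.

(** * Maximal tori of the orthogonal group *)

Section OrthogonalNormalForm.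
Variable R : rcfType.
Implicit Types (m n k : nat) (a b : R).

Lemma row_mul_tr n (v w : 'rV[R]_n) : v *m w^T = ((v *m w^T) 0 0)%:M.
Proof. exact: mx11_scalar. Qed.

Lemma row_mul_trC n (v w : 'rV[R]_n) : (v *m w^T) 0 0 = (w *m v^T) 0 0.
Proof. by rewrite !mxE; apply: eq_bigr => i _; rewrite !mxE mulrC. Qed.

Lemma row_norm_ge0 n (v : 'rV[R]_n) : 0 <= (v *m v^T) 0 0.
Proof. by rewrite mxE sumr_ge0 // => i _; rewrite mxE -expr2 sqr_ge0. Qed.

Lemma row_norm_eq0 n (v : 'rV[R]_n) : (v *m v^T) 0 0 = 0 -> v = 0.
Proof.
rewrite mxE => /eqP; rewrite psumr_eq0 => [/allP v0|i _]; last first.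
  by rewrite mxE -expr2 sqr_ge0.
apply/rowP => i; have := v0 i; rewrite mem_index_enum => /(_ isT) /=.
by rewrite !mxE -expr2 sqrf_eq0 => /eqP.
Qed.

Lemma row_normalize n (v : 'rV[R]_n) : v != 0 ->
  exists2 r : R, r != 0 & (r *: v) *m (r *: v)^T = 1%:M.
Proof.
move=> v0; have nv : 0 < (v *m v^T) 0 0.
  rewrite lt_def row_norm_ge0 andbT; apply: contraNneq v0.
  by move/row_norm_eq0 => ->.
have := row_mul_tr v v; move: nv; set q := (v *m v^T) 0 0 => nv vv.
exists (Num.sqrt q)^-1; first by rewrite invr_eq0 gt_eqF // sqrtr_gt0.
rewrite linearZ /= -scalemxAl -scalemxAr scalerA vv.
by rewrite -invfM -expr2 sqr_sqrtr ?ltW // scale_scalar_mx mulVf // gt_eqF.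
Qed.

(* Householder reflection. *)
Lemma exists_reflection n (v w : 'rV[R]_n) :
  v *m v^T = 1%:M -> w *m w^T = 1%:M ->
  exists2 H : 'M[R]_n, H *m H^T = 1%:M & v *m H = w.
Proof.
move=> v1 w1; have [->|vw] := eqVneq v w.
  by exists 1%:M; rewrite ?mulmx1 // trmx1 mulmx1.
(* The mirror is orthogonal to [d]; since |d|^2 = 2 (1 - p), the reflection coefficient 2 / |d|^2 is
   [t]. *)
move Ed: (v - w) => d; pose p := (v *m w^T) 0 0; pose t := (1 - p)^-1.
have wv : w *m v^T = p%:M by rewrite row_mul_tr row_mul_trC.
have vw' : v *m w^T = p%:M by rewrite row_mul_tr.
have vd : v *m d^T = (1 - p)%:M.
  by rewrite -Ed linearB /= mulmxBr v1 vw' [in RHS]raddfB.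
have wd : w *m d^T = (p - 1)%:M.
  by rewrite -Ed linearB /= mulmxBr w1 wv [in RHS]raddfB.
have dd : d *m d^T = ((1 - p) *+ 2)%:M.
  by rewrite -{1}Ed mulmxBl vd wd -raddfB; congr (_%:M); ring.
have p1 : 1 - p != 0.
  apply: contraNneq vw => p1; rewrite -subr_eq0 Ed; apply/eqP.
  by apply: row_norm_eq0; rewrite dd p1 mul0rn mxE mul0rn.
pose H := 1%:M - t *: (d^T *m d).
have HT : H^T = H.
  by rewrite /H linearB /= trmx1 linearZ /= trmx_mul trmxK.
exists H; last first.
  rewrite /H mulmxBr mulmx1 -scalemxAr mulmxA vd mul_scalar_mx scalerA.
  by rewrite mulVf // scale1r -Ed opprB addrC subrK.
have TT : (d^T *m d) *m (d^T *m d) = ((1 - p) *+ 2) *: (d^T *m d).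
  by rewrite mulmxA -[_ *m d^T]mulmxA dd mul_mx_scalar scalemxAl.
rewrite HT /H mulmxBl mul1mx mulmxBr mulmx1 -scalemxAl -scalemxAr TT !scalerA.
have -> : t * t * ((1 - p) *+ 2) = t + t by rewrite /t; field.
by rewrite scalerDl opprB addrK subrK.
Qed.

(** A reflection sends the first row to the first basis vector. Orthogonality clears the first
    coordinate of the other rows, which are completed in one dimension less, and the result is
    reflected back. *)
Lemma orthonormal_completion k n (A : 'M[R]_(k, k + n)) :
  A *m A^T = 1%:M ->
  exists2 B : 'M[R]_(n, k + n), B *m B^T = 1%:M & A *m B^T = 0.
Proof.
elim: k A => [|k IH] A AA.
  by exists 1%:M; [rewrite trmx1 mulmx1 | apply: flatmx0].
move: A AA; rewrite -[k.+1]/(1 + k)%N -[(1 + k + n)%N]/(1 + (k + n))%N => A.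
rewrite -[A]vsubmxK; set a := usubmx A; set A' := dsubmx A => AA.
have [aa aA' A'A'] : [/\ a *m a^T = 1%:M, A' *m a^T = 0 & A' *m A'^T = 1%:M].
  move: AA; rewrite tr_col_mx mul_col_row (scalar_mx_block 1 k).
  by move/eq_block_mx => -[].
pose e0 : 'rV[R]_(1 + (k + n)) := row_mx 1%:M 0.
have e01 : e0 *m e0^T = 1%:M.
  by rewrite tr_row_mx mul_row_col trmx1 mulmx1 mul0mx addr0.
have [H HH aH] := exists_reflection aa e01.
have HH' : H^T *m H = 1%:M by apply: mulmx1C.
pose A2 := rsubmx (A' *m H : 'M[R]_(k, 1 + (k + n))).
have A'H : A' *m H = row_mx 0 A2.
  rewrite -[LHS](@hsubmxK _ k 1 (k + n)); congr (row_mx _ _).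
  have : A' *m H *m e0^T = 0.
    by rewrite -aH trmx_mul mulmxA -[A' *m H *m _]mulmxA HH mulmx1.
  by rewrite -{1}[A' *m H](@hsubmxK _ k 1 (k + n)) tr_row_mx mul_row_col
    trmx0 mulmx0 addr0 trmx1 mulmx1.
have [|B BB A2B] := IH A2.
  have : (A' *m H) *m (A' *m H)^T = 1%:M.
    by rewrite trmx_mul mulmxA -[A' *m H *m _]mulmxA HH mulmx1.
  by rewrite A'H tr_row_mx mul_row_col mul0mx add0r.
exists (row_mx 0 B *m H^T).
  rewrite trmx_mul trmxK mulmxA -[_ *m H^T *m H]mulmxA HH' mulmx1.
  by rewrite tr_row_mx mul_row_col mul0mx add0r.
rewrite trmx_mul trmxK mulmxA mul_col_mx aH A'H mul_col_mx tr_row_mx.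
rewrite !mul_row_col trmx0 !mulmx0 mul0mx !add0r A2B.
by rewrite col_mx0.
Qed.

Definition rotation a b : 'M[R]_(1 + 1) := block_mx a%:M (- b)%:M b%:M a%:M.

(** When a^2 + b^2 = 1 the complex roots are a + ib and a - ib. *)
Definition quad a : {poly R} := 'X^2 - (a *+ 2) *: 'X + 1.

Lemma char_poly_rotation a b : a ^+ 2 + b ^+ 2 = 1 ->
  char_poly (rotation a b) = quad a.
Proof.
move=> ab.
have -> : rotation a b =
    \matrix_(i, j) (if i == j then a else if i == 0 then - b else b).
  apply/matrixP => i j; rewrite [RHS]mxE /rotation.
  case: (@split_ordP 1 1 i) => i' ->; case: (@split_ordP 1 1 j) => j' ->;
    rewrite ?(block_mxEul, block_mxEur, block_mxEdl, block_mxEdr) !ord1;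
    by rewrite mxE eqxx mulr1n.
rewrite /char_poly (expand_det_row _ 0) !big_ord_recl big_ord0 addr0.
rewrite /cofactor !det_mx11 !mxE /=.
have -> : quad a = 'X^2 - (a *+ 2)%:P * 'X + (a ^+ 2 + b ^+ 2)%:P.
  by rewrite /quad ab mul_polyC.
by rewrite /bump /= polyCMn polyCN polyCD !polyC_exp; ring.
Qed.

Lemma rotation_orthogonal a b : a ^+ 2 + b ^+ 2 = 1 ->
  rotation a b *m (rotation a b)^T = 1%:M.
Proof.
move=> ab; rewrite /rotation tr_block_mx mulmx_block !tr_scalar_mx.
rewrite -!scalar_mxM -!raddfD (scalar_mx_block 1 1) /=.
have -> : a * b + - b * a = 0 by ring.
have -> : b * a + a * - b = 0 by ring.
have -> : a * a + - b * - b = 1 by rewrite -ab; ring.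
have -> : b * b + a * a = 1 by rewrite -ab; ring.
by rewrite !raddf0.
Qed.

Lemma char_poly_conj n (Q A : 'M[R]_n) : Q *m Q^T = 1%:M ->
  char_poly (Q^T *m A *m Q) = char_poly A.
Proof.
move=> QQ; have QQ' := mulmx1C QQ.
pose P := map_mx (@polyC R) Q; rewrite /char_poly.
have PP : P^T *m P = 1%:M by rewrite /P map_trmx -map_mxM QQ' map_mx1.
have -> : char_poly_mx (Q^T *m A *m Q) = P^T *m char_poly_mx A *m P.
  rewrite /char_poly_mx mulmxBr mulmxBl !map_mxM -map_trmx; congr (_ - _).
  by rewrite mul_mx_scalar -scalemxAl PP scalemx1.
rewrite !det_mulmx mulrAC -det_mulmx PP det1 mul1r //.
Qed.

Lemma char_poly_block_diag k n (A : 'M[R]_k) (B : 'M[R]_n) :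
  char_poly (block_mx A 0 0 B) = char_poly A * char_poly B.
Proof. by rewrite /char_poly char_block_diag_mx det_ublock. Qed.

(** The rows of [A] span an invariant subspace, and an orthogonal [g] also preserves its orthogonal
    complement. *)
Lemma orthogonal_deflation k n (g : 'M[R]_(k + n)) (A : 'M[R]_(k, k + n))
    (C : 'M[R]_k) :
  g *m g^T = 1%:M -> A *m A^T = 1%:M -> A *m g = C *m A ->
  exists (Q : 'M[R]_(k + n)) (g' : 'M[R]_n),
    [/\ Q *m Q^T = 1%:M, g' *m g'^T = 1%:M, usubmx Q = A &
        g = Q^T *m block_mx C 0 0 g' *m Q].
Proof.
move=> gg AA Ag; have [B BB AB] := orthonormal_completion AA.
have BA : B *m A^T = 0.
  by have := congr1 trmx AB; rewrite trmx_mul trmxK trmx0.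
have CC : C *m C^T = 1%:M.
  have : (A *m g) *m (A *m g)^T = 1%:M.
    by rewrite trmx_mul mulmxA -[A *m g *m _]mulmxA gg mulmx1.
  by rewrite Ag trmx_mul mulmxA -[C *m A *m _]mulmxA AA mulmx1.
(* As [C] is orthogonal, the row space of [A] is invariant under [g^T] too, which makes the lower
   left block [B *m g *m A^T] vanish. *)
have gA : g *m A^T = A^T *m C.
  apply: trmx_inj; rewrite !trmx_mul !trmxK.
  rewrite -[RHS](mulmx1) -gg mulmxA -[C^T *m A *m g]mulmxA Ag mulmxA.
  by rewrite (mulmx1C CC) mul1mx.
pose Q := col_mx A B; pose g' := B *m g *m B^T.
have QQ : Q *m Q^T = 1%:M.
  by rewrite tr_col_mx mul_col_row AA AB BA BB -scalar_mx_block.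
have QQ' := mulmx1C QQ.
have Qg : Q *m g *m Q^T = block_mx C 0 0 g'.
  rewrite /Q mul_col_mx tr_col_mx mul_col_row Ag -!mulmxA AA AB mulmx0 mulmx1.
  by rewrite gA !mulmxA BA mul0mx.
have eg : g = Q^T *m block_mx C 0 0 g' *m Q.
  by rewrite -Qg !mulmxA QQ' mul1mx -mulmxA QQ' mulmx1.
exists Q, g'; split=> //; last by rewrite col_mxKu.
have : (Q *m g *m Q^T) *m (Q *m g *m Q^T)^T = 1%:M.
  rewrite !trmx_mul trmxK !mulmxA -[_ *m Q^T *m Q]mulmxA QQ' mulmx1.
  by rewrite -[_ *m g *m g^T]mulmxA gg mulmx1.
rewrite Qg tr_block_mx mulmx_block scalar_mx_block => /eq_block_mx [_ _ _].
by rewrite trmx0 mul0mx add0r.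
Qed.

(** A complex eigenvector of [g] for a + ib is one of [g^T], the inverse of [g], for a - ib. So g +
    g^T - 2a is singular and, being real, has a real kernel vector. *)
Lemma quad_kernel n (g : 'M[R]_n) a b :
  g *m g^T = 1%:M -> a ^+ 2 + b ^+ 2 = 1 -> quad a %| char_poly g ->
  exists2 v : 'rV[R]_n, v != 0 & v *m (g + g^T) = (a *+ 2) *: v.
Proof.
move=> gg ab /dvdpP[r cg]; pose f := real_complex R.
pose x : R[i] := (a +i* b)%C; pose y : R[i] := (a -i* b)%C.
have xy : x * y = 1.
  apply/eqP; rewrite eq_complex /=; apply/andP; split; apply/eqP; last by ring.
  by rewrite -ab; ring.
have xDy : x + y = f (a *+ 2).
  by apply/eqP; rewrite eq_complex /= mulr2n subrr !eqxx.
have : eigenvalue (map_mx f g) x.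
  rewrite eigenvalue_root_char -map_char_poly cg rmorphM /= rootM.
  apply/orP; right; rewrite /root /quad.
  rewrite rmorphD rmorphB /= rmorph1 map_polyXn map_polyZ map_polyX.
  rewrite !hornerE -[X in _ - X * _]xDy mulrDl -expr2 [y * x]mulrC xy opprD addrA subrr add0r.
  by rewrite addNr.
case/eigenvalueP => v vg v0.
have vg' : v *m (map_mx f g)^T = y *: v.
  rewrite -[v in LHS]scale1r -xy mulrC -scalerA -vg -scalemxAl -mulmxA.
  by rewrite map_trmx -map_mxM gg map_mx1 mulmx1.
have : \det (g + g^T - (a *+ 2)%:M) == 0.
  rewrite -(fmorph_eq0 f) -det_map_mx; apply/det0P; exists v => //.
  rewrite map_mxB map_mxD map_scalar_mx mulmxBr mulmxDr -map_trmx vg vg'.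
  by rewrite mul_mx_scalar -scalerDl xDy subrr.
case/det0P => w w0; rewrite mulmxBr mul_mx_scalar => /eqP.
by rewrite subr_eq0 => /eqP; exists w.
Qed.

(** A vector [v] from [quad_kernel] satisfies v g^2 = 2a v g - v, so [v] and [v *m g] span an
    invariant subspace. It is a plane if b is nonzero; otherwise [v] is an eigenvector, and a second
    one comes from the double root a. *)
Lemma invariant_plane n (g : 'M[R]_(1 + 1 + n)) a b :
  g *m g^T = 1%:M -> a ^+ 2 + b ^+ 2 = 1 -> quad a %| char_poly g ->
  exists2 A : 'M[R]_(1 + 1, 1 + 1 + n), A *m A^T = 1%:M &
    A *m g = rotation a b *m A.
Proof.
move=> gg ab qg; have [v0 v00 v0g] := quad_kernel gg ab qg.
have [t _ vv] := row_normalize v00.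
move Ev: (t *: v0) => v in vv.
have {v0 v00 v0g t Ev} vg : v *m g^T = (a *+ 2) *: v - v *m g.
  apply/eqP; rewrite eq_sym subr_eq addrC -mulmxDr -Ev -scalemxAl v0g.
  by rewrite !scalerA mulrC.
have gg' := mulmx1C gg.
have vgg : v *m g *m g = (a *+ 2) *: (v *m g) - v.
  by rewrite -[X in _ - X]mulmx1 -gg' mulmxA vg mulmxBl -scalemxAl opprB addrC subrK.
have ngg : (v *m g) *m (v *m g)^T = 1%:M.
  by rewrite trmx_mul mulmxA -[_ *m g *m _]mulmxA gg mulmx1.
(* [v *m g] and [v *m g^T] have equal inner products with [v], and they sum to 2a v. *)
have vgv : v *m g *m v^T = a%:M.
  have h : v *m g^T *m v^T = v *m g *m v^T.
    rewrite [RHS]row_mul_tr row_mul_trC -row_mul_tr.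
    by rewrite trmx_mul mulmxA.
  move: h; rewrite vg mulmxBl -scalemxAl vv (row_mul_tr (v *m g)).
  move: ((v *m g *m v^T) 0 0) => q /matrixP/(_ 0 0).
  by rewrite !mxE eqxx !mulr1n mulr1 => h; congr (_%:M); lra.
have vvg : v *m (v *m g)^T = a%:M.
  by rewrite row_mul_tr row_mul_trC -row_mul_tr.
have [b0|b0] := eqVneq b 0; last first.
  (* Gram-Schmidt: the squared norm of a v - v g is 1 - a^2 = b^2, and the sign is the one matching
     [rotation]. *)
  pose w := b^-1 *: (a *: v - v *m g).
  have wT : w^T = b^-1 *: (a *: v^T - (v *m g)^T).
    by rewrite /w linearZ linearB linearZ.
  have vw : v *m w^T = 0.
    rewrite wT -scalemxAr mulmxBr -scalemxAr vv vvg scalemx1 subrr scaler0 //.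
  have ww : w *m w^T = 1%:M.
    rewrite {1}/w -scalemxAl mulmxBl -scalemxAl vw scaler0 add0r wT.
    rewrite -scalemxAr mulmxBr -scalemxAr vgv ngg.
    rewrite -scalerN scalerA opprB scale_scalar_mx -raddfB /= scale_scalar_mx.
    congr (_%:M); rewrite (_ : 1 - a * a = b ^+ 2) ?expr2; last by rewrite -ab; ring.
    by field.
  exists (col_mx v w).
    rewrite tr_col_mx mul_col_row vv vw ww.
    by rewrite -[w *m _]trmxK trmx_mul trmxK vw trmx0 -scalar_mx_block.
  rewrite mul_col_mx /rotation mul_block_col !mul_scalar_mx.
  congr col_mx; rewrite /w.
    rewrite scalerA (_ : - b * b^-1 = -1); last by field.
    by rewrite scaleN1r opprB addrC subrK.
  rewrite -scalemxAl mulmxBl -scalemxAl vgg.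
  move: (v *m g) => u; apply/rowP => i; rewrite !mxE.
  rewrite -[X in _ - (_ - X)]mul1r -ab; by field.
have {}ab : a * a = 1 by rewrite -ab b0; ring.
have {vgg vvg} vga : v *m g = a *: v.
  apply/eqP; rewrite -subr_eq0; apply/eqP; apply: row_norm_eq0.
  have -> : (v *m g - a *: v)^T = (v *m g)^T - a *: v^T by rewrite linearB linearZ.
  rewrite mulmxBr !mulmxBl -!scalemxAr -!scalemxAl.
  rewrite ngg vgv vvg vv !mxE eqxx !mulr1n; lra.
have vaM : v *m (g : 'M[R]_(1 + (1 + n))) = a%:M *m v by rewrite mul_scalar_mx.
have [Q [g1 [QQ gg1 Qv eg]]] :=
  @orthogonal_deflation 1 (1 + n) g v a%:M gg vv vaM.
case/dvdpP: qg => r cg.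
have QQ' := mulmx1C QQ.
(* One factor of the double root goes with [v]; the other stays in the block on its complement. *)
have cg1 : char_poly g1 = r * ('X - a%:P).
  have c1 : char_poly (a%:M : 'M[R]_1) = 'X - a%:P.
    by rewrite /char_poly det_mx11 !mxE eqxx !mulr1n.
  have : char_poly g = ('X - a%:P) * char_poly g1.
    by rewrite eg (char_poly_conj _ QQ) (@char_poly_block_diag 1 (1 + n)) c1.
  rewrite cg; have -> : quad a = ('X - a%:P) * ('X - a%:P).
    have -> : quad a = 'X^2 - (a *+ 2)%:P * 'X + (a * a)%:P.
      by rewrite /quad ab mul_polyC.
    by rewrite polyCMn polyCM; ring.
  by rewrite mulrCA => /(mulfI (negbT (polyXsubC_eq0 a))).
have : eigenvalue g1 a.
  by rewrite eigenvalue_root_char cg1 rootM root_XsubC eqxx orbT.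
case/eigenvalueP => w0 w0g w00; have [t _ ww] := row_normalize w00.
move Ew: (t *: w0) => w in ww.
have {w0g w00} wg : w *m g1 = a *: w.
  by rewrite -Ew -scalemxAl w0g !scalerA mulrC.
pose u : 'rV[R]_(1 + (1 + n)) := row_mx 0 w *m Q.
have uu : u *m u^T = 1%:M.
  rewrite trmx_mul mulmxA -[_ *m Q *m _]mulmxA QQ mulmx1.
  by rewrite tr_row_mx mul_row_col mul0mx add0r.
have vQ : v = row_mx 1%:M 0 *m Q.
  by rewrite -[Q]vsubmxK mul_row_col mul1mx mul0mx addr0 Qv.
have vu : v *m u^T = 0.
  rewrite vQ trmx_mul mulmxA -[_ *m Q *m _]mulmxA QQ mulmx1.
  by rewrite tr_row_mx mul_row_col trmx0 mulmx0 mul0mx addr0.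
have ug : u *m g = a *: u.
  rewrite eg /u !mulmxA -[row_mx 0 w *m Q *m Q^T]mulmxA QQ mulmx1.
  rewrite mul_row_block !mul0mx mulmx0 !add0r wg scalemxAl.
  by rewrite scale_row_mx scaler0.
exists (col_mx v u).
  rewrite tr_col_mx mul_col_row vv vu uu.
  by rewrite -[u *m v^T]trmxK trmx_mul trmxK vu trmx0 -scalar_mx_block.
rewrite mul_col_mx vga ug /rotation b0 oppr0 mul_block_col !mul_scalar_mx.
by rewrite !scale0r addr0 add0r.
Qed.

(** Invariant planes are split off one by one, each with its own angle. The family is affine in the
    cosines and sines, hence continuous in them. A variable [n] lets each step retype the dimension
    as [1 + 1 + (2 * m + 1)]. *)
Lemma orthogonal_torus m n (g : 'M[R]_n) (c s : 'I_m -> R) (e : R) :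
  n = (2 * m + 1)%N -> g *m g^T = 1%:M ->
  (forall i, c i ^+ 2 + s i ^+ 2 = 1) ->
  char_poly g = ('X - e%:P) * \prod_(i < m) quad (c i) ->
  exists (G0 : 'M[R]_n) (A B : 'I_m -> 'M[R]_n),
    let G (c s : 'I_m -> R) := G0 + \sum_(i < m) (c i *: A i + s i *: B i) in
    g = G c s /\
    forall c' s' : 'I_m -> R, (forall i, c' i ^+ 2 + s' i ^+ 2 = 1) ->
      G c' s' *m (G c' s')^T = 1%:M /\
      char_poly (G c' s') = ('X - e%:P) * \prod_(i < m) quad (c' i).
Proof.
elim: m n g c s => [|m IH] n g c s en gg cs cg.
  exists g, (fun=> 0), (fun=> 0) => /=; rewrite !big_ord0 addr0; split=> // c' s' _.
  by rewrite !big_ord0 addr0 cg big_ord0.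
have {}en : n = (1 + 1 + (2 * m + 1))%N by lia.
subst n; rewrite big_ord_recl mulrCA in cg.
have [|A AA Ag] := invariant_plane gg (cs ord0); first by rewrite cg dvdp_mulIl.
have [Q [g1 [QQ gg1 _ eg]]] := orthogonal_deflation gg AA Ag.
have cg1 : char_poly g1 =
    ('X - e%:P) * \prod_(i < m) quad (c (lift ord0 i)).
  move: cg; rewrite eg char_poly_conj // char_poly_block_diag.
  rewrite (char_poly_rotation (cs ord0)) => /mulfI; apply.
  rewrite -(char_poly_rotation (cs ord0)); exact: monic_neq0 (char_poly_monic _).
have [G0 [A1 [B1 [/= eg1 H1]]]] := IH _ g1 (fun i => c (lift ord0 i))
  (fun i => s (lift ord0 i)) erefl gg1 (fun i => cs _) cg1.
pose T (D : 'M[R]_(1 + 1)) (M : 'M[R]_(2 * m + 1)) :=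
  Q^T *m block_mx D 0 0 M *m Q.
have TD D D' M M' : T D M + T D' M' = T (D + D') (M + M').
  by rewrite /T -mulmxDl -mulmxDr add_block_mx !addr0.
have TZ a D M : a *: T D M = T (a *: D) (a *: M).
  by rewrite /T scalemxAl scalemxAr scale_block_mx !scaler0.
have TS (F : 'I_m -> 'M[R]_(2 * m + 1)) : \sum_i T 0 (F i) = T 0 (\sum_i F i).
  have T00 : T 0 0 = 0 by rewrite /T block_mx0 mulmx0 mul0mx.
  by elim/big_rec2: _ => [|i M N _ ->]; rewrite ?T00 // TD addr0.
pose ext (D : 'M[R]_(1 + 1)) (F : 'I_m -> 'M[R]_(2 * m + 1)) (i : 'I_m.+1) :=
  if unlift ord0 i is Some j then T 0 (F j) else T D 0.
exists (T 0 G0), (ext 1%:M A1), (ext (rotation 0 1) B1) => /=.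
have GE c' s' : T 0 G0 + \sum_(i < m.+1)
      (c' i *: ext 1%:M A1 i + s' i *: ext (rotation 0 1) B1 i) =
    T (rotation (c' ord0) (s' ord0))
      (G0 + \sum_(i < m) (c' (lift ord0 i) *: A1 i + s' (lift ord0 i) *: B1 i)).
  rewrite big_ord_recl /ext unlift_none !TZ TD !scaler0 addr0.
  under eq_bigr => i _ do rewrite liftK !TZ TD !scaler0 addr0.
  rewrite TS !TD !add0r addr0; congr (T _ _).
  rewrite /rotation (scalar_mx_block 1 1) !scale_block_mx add_block_mx.
  rewrite !scale_scalar_mx !scaler0 !mulr1 !mulr0 mulrN1 !raddf0 !addr0 !add0r.
  by [].
split=> [|c' s' cs']; first by rewrite GE /= -eg1.
rewrite GE; have [HG HC] := H1 _ _ (fun i => cs' (lift ord0 i)).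
split.
  have QQ' := mulmx1C QQ.
  rewrite /T !trmx_mul trmxK !mulmxA -[_ *m Q *m Q^T]mulmxA QQ mulmx1.
  rewrite -[_ *m _ *m (block_mx _ _ _ _)^T]mulmxA tr_block_mx mulmx_block !trmx0.
  rewrite !mul0mx !mulmx0 !addr0 !add0r rotation_orthogonal // HG.
  by rewrite -scalar_mx_block mulmx1 QQ'.
rewrite /T char_poly_conj // char_poly_block_diag char_poly_rotation //.
by rewrite HC big_ord_recl mulrCA.
Qed.

End OrthogonalNormalForm.

(** * Complex eigenvalues of orthogonal matrices *)

Section ComplexEigenvalues.
Variable R : realType.
Notation C := (Cplx R).
Implicit Types (x y : C).

Lemma normC1_conj x : `|x| = 1 -> x^-1 = Num.conj x.
Proof.
move=> x1; have x0 : x != 0 by rewrite -normr_gt0 x1.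
by apply: (mulfI x0); rewrite divff // -normCK x1 expr1n.
Qed.

Lemma toC_Re x : `|x| = 1 -> toC (complex.Re x *+ 2) = x + x^-1.
Proof.
move=> x1; rewrite normC1_conj //; case: x {x1} => a b.
by apply/eqP; rewrite eq_complex /= subrr mulr2n !eqxx.
Qed.

Lemma Re_Im_sqr x : `|x| = 1 -> complex.Re x ^+ 2 + complex.Im x ^+ 2 = 1.
Proof.
move=> x1; have := add_Re2_Im2 x; rewrite [Num.norm x]x1 expr1n => e.
by have [] := e.
Qed.

Lemma map_quad x : `|x| = 1 ->
  map_poly (@toC R) (quad (complex.Re x)) = ('X - x%:P) * ('X - (x^-1)%:P).
Proof.
move=> x1; have x0 : x != 0 by rewrite -normr_gt0 x1.
rewrite /quad rmorphD rmorphB /= rmorph1 map_polyXn map_polyZ map_polyX.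
rewrite [X in _ - X *: _](toC_Re x1) -mul_polyC polyCD.
have -> : 1 = (x%:P * (x^-1)%:P) :> {poly C} by rewrite -polyCM divff.
by ring.
Qed.

(** A real orthogonal [g] preserves the Hermitian norm of an eigenvector, which it also multiplies
    by |x|. *)
Lemma orthogonal_eigenvalue_norm n (g : 'M[R]_n) x :
  orthogonal_group g -> root (char_poly (map_mx (@toC R) g)) x -> `|x| = 1.
Proof.
move=> gg; rewrite -eigenvalue_root_char => /eigenvalueP[v vg v0].
pose w := map_mx Num.conj v.
have wg : w *m map_mx (@toC R) g = Num.conj x *: w.
  rewrite -map_mxZ -vg map_mxM; congr (_ *m _).
  by apply/matrixP => i j; rewrite !mxE; apply/eqP; rewrite eq_complex /= oppr0 !eqxx.
have e : v *m w^T = (x * Num.conj x) *: (v *m w^T).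
  rewrite mulrC -scalerA scalemxAl scalemxAr -vg -[Num.conj x *: w^T]linearZ -wg /=.
  by rewrite trmx_mul mulmxA -[_ *m map_mx _ g *m _]mulmxA [(map_mx _ g)^T]map_trmx
    -(map_mxM (real_complex R))
    gg map_mx1 mulmx1.
have nz : (v *m w^T) 0 0 != 0.
  rewrite mxE; under eq_bigr do rewrite !mxE -normCK.
  rewrite psumr_eq0 => [|i _]; last exact: exprn_ge0.
  apply: contra v0 => /allP h; apply/eqP/rowP => i; rewrite mxE.
  by have := h i; rewrite mem_index_enum sqrf_eq0 normr_eq0 => /(_ isT)/eqP.
have : 1 * (v *m w^T) 0 0 = (x * Num.conj x) * (v *m w^T) 0 0.
  by rewrite mul1r {1}e mxE.
move/(mulIf nz); rewrite -normCK => /esym/eqP.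
by rewrite sqrf_eq1 => /orP[/eqP -> //|/eqP h]; have := normr_ge0 x;
  rewrite h lerNr oppr0 ler10.
Qed.

Section Eigenvalues.
Variables (m : nat) (g : 'M[R]_(2 * m + 1)).

Lemma has_eigenvalues_norm (x : 'rV[C]_m) i :
  orthogonal_group g -> has_eigenvalues g x -> `|x 0 i| = 1.
Proof.
move=> gg gx; apply: (orthogonal_eigenvalue_norm gg); rewrite gx rootM.
by rewrite (bigD1 i) //= !rootM !root_XsubC eqxx /= orbT.
Qed.

Lemma has_eigenvalues_quad (x : 'rV[C]_m) :
  (forall i, `|x 0 i| = 1) -> has_eigenvalues g x <->
  char_poly g = ('X - (\det g)%:P) * \prod_(i < m) quad (complex.Re (x 0 i)).
Proof.
move=> x1; rewrite /has_eigenvalues -(map_char_poly (real_complex R)).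
have -> : ('X - (toC (\det g))%:P) *
      \prod_(i < m) (('X - (x 0 i)%:P) * ('X - ((x 0 i)^-1)%:P)) =
    map_poly (real_complex R)
     (('X - (\det g)%:P) * \prod_(i < m) quad (complex.Re (x 0 i))).
  rewrite rmorphM rmorph_prod /= rmorphB /= map_polyX map_polyC; congr (_ * _).
  by apply: eq_bigr => i _; rewrite -map_quad.
split=> [/map_poly_inj //|-> //].
Qed.

(** Compare constant terms: each [quad] contributes 1, and the dimension is odd. *)
Lemma char_poly_quad_det (c : 'I_m -> R) (e : R) :
  char_poly g = ('X - e%:P) * \prod_(i < m) quad (c i) -> \det g = e.
Proof.
move=> cg; have := char_poly_det g.
rewrite cg -horner_coef0 hornerM horner_prod big1 => [|i _]; last first.
  by rewrite /quad !hornerE expr0n /= subr0 add0r.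
rewrite !hornerE -signr_odd oddD oddM /= mulN1r => /eqP.
by rewrite eqr_opp => /eqP.
Qed.

End Eigenvalues.

Lemma orthogonal_det (n : nat) (g : 'M[R]_n) :
  orthogonal_group g -> toC (\det g) * toC (\det g) = 1.
Proof.
move=> gg; rewrite -[LHS](rmorphM (real_complex R)) -{2}(det_tr g) -det_mulmx.
by rewrite gg det1.
Qed.

(** The eigenvalues move freely on the unit circle along a torus through [g], while the determinant
    stays fixed. *)
Lemma orthogonal_perturbation m (g : 'M[R]_(2 * m + 1)) (x : 'rV[C]_m) :
  orthogonal_group g -> has_eigenvalues g x ->
  exists (G0 : 'M[R]_(2 * m + 1)) (A B : 'I_m -> 'M[R]_(2 * m + 1)),
    let G (x : 'rV[C]_m) := G0 +
      \sum_(i < m) (complex.Re (x 0 i) *: A i + complex.Im (x 0 i) *: B i) in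
    g = G x /\
    forall x' : 'rV[C]_m, (forall i, `|x' 0 i| = 1) ->
      [/\ orthogonal_group (G x'), has_eigenvalues (G x') x' &
          \det (G x') = \det g].
Proof.
move=> gg gx; have x1 i := has_eigenvalues_norm i gg gx.
have /(has_eigenvalues_quad _ x1) cg := gx.
have [G0 [A [B [/= eg H]]]] := orthogonal_torus erefl gg
   (fun i => Re_Im_sqr (x1 i)) cg.
exists G0, A, B; split=> // x' x'1.
have [] := H _ _ (fun i => Re_Im_sqr (x'1 i)).
set G := G0 + _ => GG cG; have dG := char_poly_quad_det cG.
by split=> //; apply/has_eigenvalues_quad => //; rewrite dG.
Qed.

End ComplexEigenvalues.

(** * Limits of determinants and divided differences *)

Section Limits.
Variables (K : numFieldType) (T : Type) (F : set_system T).
Context {FF : Filter F}.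

Lemma cvg_det n (A : T -> 'M[K]_n) (B : 'M[K]_n) :
  (forall i j, A t i j @[t --> F] --> B i j) -> \det (A t) @[t --> F] --> \det B.
Proof.
move=> AB; apply: cvg_big => [|s _]; first exact: add_continuous.
apply: cvgM; first exact: cvg_cst.
by apply: cvg_big => [|i _]; first exact: mul_continuous.
Qed.

Lemma cvg_chebquo (u : T -> K) (u0 : K) (f : T -> nat -> K) (f0 : nat -> K) n :
  u t @[t --> F] --> u0 -> (forall k, f t k @[t --> F] --> f0 k) ->
  chebquo (u t) (f t) n @[t --> F] --> chebquo u0 f0 n.
Proof.
move=> uu ff; elim/ltn_ind: n => -[|[|n]] IH; first exact: ff.
  by apply: cvgD (ff 1%N); apply: cvgM uu (ff 0%N).
apply: cvgD (ff n.+2); apply: cvgB (IH n (leqnSn n.+1)).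
exact: cvgM uu (IH n.+1 (leqnn n.+2)).
Qed.

Lemma cvg_divdiff (v : T -> nat -> K) (v0 : nat -> K) (f : nat -> K) k n :
  (forall i, v t i @[t --> F] --> v0 i) ->
  divdiff f (v t) k n @[t --> F] --> divdiff f v0 k n.
Proof.
move=> vv; rewrite /divdiff; apply: cvg_chebquo => [//|{n}].
elim: k => [|k IH] n /=; first exact: cvg_cst.
by case: n => [|n] /=; [exact: cvg_cst | apply: cvg_chebquo].
Qed.

End Limits.

(** * Characters at arbitrary group elements *)

Section CharacterFormula.
Variable R : realType.
Notation C := (Cplx R).

Section Schur.
Variable m : nat.
Implicit Types (x s : 'rV[C]_m) (a : 'I_m -> nat) (e : C).

(** Extended by 0 because [divdiff] takes nodes indexed by all natural numbers. *)
Definition trace_seq x (k : nat) : C :=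
  if insub k is Some i then x 0 i + (x 0 i)^-1 else 0.

Lemma trace_seq_ord x (i : 'I_m) : trace_seq x i = x 0 i + (x 0 i)^-1.
Proof. by rewrite /trace_seq valK. Qed.

(* The Weyl quotient with the Vandermonde determinants cancelled: a polynomial
   in the x_i + x_i^-1, so it also makes sense where the quotient does not. *)
Definition orthogonal_schur e x a : C := reversal_sign C m *
  \det (\matrix_(i < m, j < m) divdiff (weyl_series e) (trace_seq x) i (a j)).

(** [weyl_poly_ratio] takes a factor out of each row and [det_chebquo] the Vandermonde product.
    Neither depends on [a], so both cancel in the Weyl quotient. *)
Lemma weyl_detE a e s : (forall i, s 0 i != 0) -> e * e = 1 ->
  let u := trace_seq (\row_i s 0 i ^+ 2) in
  weyl_det a e s =
  (\prod_(i < m) (s 0 i - e * (s 0 i)^-1)) *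
  (\prod_(i < m) \prod_(l < i) (u i - u l)) *
  \det (\matrix_(i < m, j < m)
     divdiff (weyl_series e) u i (a j + (m - j.+1))).
Proof.
move=> s0 ee u; rewrite -mulrA -det_chebquo /weyl_det.
rewrite (_ : \matrix_(i, j) _ = diag_mx (\row_i (s 0 i - e * (s 0 i)^-1)) *m
  \matrix_(i < m, j < m) chebquo (u i) (weyl_series e) (a j + (m - j.+1))).
  by rewrite det_mulmx det_diag; congr (_ * _); apply: eq_bigr => i _; rewrite mxE.
apply/matrixP => i j; rewrite mul_diag_mx !mxE weyl_poly_ratio //.
by rewrite /u trace_seq_ord mxE.
Qed.

Lemma weyl_quotientE (l : partition_le m) e s :
  (forall i, s 0 i != 0) -> e * e = 1 -> weyl_den e s != 0 ->
  weyl_num l e s / weyl_den e s =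
  orthogonal_schur e (\row_i s 0 i ^+ 2) (shifted_part l).
Proof.
move=> s0 ee; rewrite /weyl_num /weyl_den !weyl_detE //=.
rewrite (_ : \det (\matrix_(i, j) divdiff _ _ _ (0 + _)) = reversal_sign C m);
  last exact: det_divdiff_rev.
rewrite mulf_eq0 => /norP[p0 r0]; rewrite /orthogonal_schur.
rewrite -mulf_div divff // mul1r mulrC; congr (_ * _).
by apply: (mulfI r0); rewrite reversal_sign_sqr divff.
Qed.

(** A row factor s - e/s vanishes only if s^2 = e. With p = s_i^2 and q = s_j^2, a Vandermonde
    factor is (p - q)(p q - 1)/(p q). *)
Lemma weyl_den_neq0 e s : (forall i, s 0 i != 0) -> e * e = 1 ->
  (forall i, s 0 i ^+ 2 != e) ->
  (forall i j : 'I_m, (j < i)%N -> s 0 i ^+ 2 != s 0 j ^+ 2) ->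
  (forall i j : 'I_m, (j < i)%N -> s 0 i ^+ 2 * s 0 j ^+ 2 != 1) ->
  weyl_den e s != 0.
Proof.
move=> s0 ee s2e ss s1; rewrite /weyl_den weyl_detE //=.
rewrite (_ : \det _ = reversal_sign C m); last exact: det_divdiff_rev.
rewrite !mulf_neq0 //; last by rewrite signr_eq0.
  apply/prodf_neq0 => i _; apply: contra (s2e i); rewrite subr_eq0 => /eqP h.
  by rewrite expr2 {1}h mulfVK.
apply/prodf_neq0 => i _; apply/prodf_neq0 => -[j ji] _ /=.
have jm : (j < m)%N by apply: ltn_trans ji _.
rewrite -[j]/(nat_of_ord (Ordinal jm)) !trace_seq_ord !mxE.
set p := s 0 i ^+ 2; set q := s 0 (Ordinal jm) ^+ 2.
have p0 : p != 0 by rewrite expf_neq0.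
have q0 : q != 0 by rewrite expf_neq0.
rewrite (_ : _ - _ = (p - q) * (p * q - 1) / (p * q)); last first.
  by field; rewrite p0 q0.
rewrite !mulf_neq0 ?subr_eq0 ?invr_eq0 ?mulf_neq0 //; first exact: (ss i).
exact: (s1 i).
Qed.

Lemma cvg_orthogonal_schur (T : Type) (F : set_system T) (x : T -> 'rV[C]_m) x0 e a :
  Filter F -> (forall i, x0 0 i != 0) ->
  (forall i, x t 0 i @[t --> F] --> x0 0 i) ->
  orthogonal_schur e (x t) a @[t --> F] --> orthogonal_schur e x0 a.
Proof.
move=> FF x00 xx; apply: cvgM; first exact: cvg_cst.
apply: cvg_det => i j; rewrite mxE; under eq_cvg do rewrite mxE.
apply: cvg_divdiff => k; rewrite /trace_seq; case: insubP => [p _ _|_].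
  by apply: cvgD (xx p) _; apply: cvgV.
exact: cvg_cst.
Qed.

End Schur.

Lemma toC_norm (t : R) : `|toC t| = toC `|t|.
Proof. by rewrite normc_def /= expr0n addr0 sqrtr_sqr. Qed.

Lemma ltr_toC (a b : R) : (toC a < toC b) = (a < b).
Proof. exact: ltcR. Qed.

(** Complex numbers are comparable only if their imaginary parts agree, so a positive one is
    real. *)
Lemma toC_pos (e : C) : 0 < e -> exists2 r : R, 0 < r & e = toC r.
Proof.
by case: e => a b; rewrite ltcE /= => /andP[/eqP -> a0]; exists a.
Qed.

Lemma cvg_toC (T : Type) (F : set_system T) (f : T -> R) (l : R) : Filter F ->
  f t @[t --> F] --> l -> toC (f t) @[t --> F] --> toC l.
Proof.
move=> FF fl; apply/cvgrPdist_lt => _ /toC_pos[e e0 ->].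
have /cvgrPdist_lt/(_ e e0) := fl; apply: filterS => t h.
by rewrite -[_ - _](rmorphB (real_complex R)) [Num.norm _]toC_norm ltr_toC.
Qed.

Lemma cvg_Re (T : Type) (F : set_system T) (f : T -> C) (l : C) : Filter F ->
  f t @[t --> F] --> l -> complex.Re (f t) @[t --> F] --> complex.Re l.
Proof.
move=> FF fl; apply/cvgrPdist_lt => e e0.
have e0' : 0 < toC e by rewrite (ltr_toC 0).
have /cvgrPdist_lt/(_ _ e0') := fl; apply: filterS => t h.
rewrite -ltr_toC; apply: le_lt_trans h.
by have := normc_ge_Re (l - f t); rewrite raddfB.
Qed.

Lemma cvg_Im (T : Type) (F : set_system T) (f : T -> C) (l : C) : Filter F ->
  f t @[t --> F] --> l -> complex.Im (f t) @[t --> F] --> complex.Im l.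
Proof.
move=> FF fl.
have ReI (x : C) : complex.Im x = complex.Re (- 'i%C * x).
  by case: x => a b /=; ring.
rewrite ReI; under eq_cvg do rewrite ReI.
by apply: cvg_Re; apply: cvgM fl; exact: cvg_cst.
Qed.

(** The Cayley transform, a rational parametrisation of the unit circle passing through 1 at t =
    0. *)
Definition circle_point (t : R) : C := (1 + 'i * toC t) / (1 - 'i * toC t).

Lemma circle_point_den (t : R) : 1 - 'i * toC t != 0.
Proof.
rewrite subr_eq0; apply/eqP => /(congr1 (fun x => x ^+ 2)) h.
have /eqP : toC (1 + t ^+ 2) = 0.
  rewrite [LHS](rmorphD (real_complex R)) rmorph1 rmorphXn /= {1}(_ : 1 = 1 ^+ 2).
    by rewrite h exprMn sqrCi mulN1r addNr.
  by rewrite expr1n.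
by rewrite (fmorph_eq0 (real_complex R)) gt_eqF // ltr_wpDr ?sqr_ge0.
Qed.

Lemma circle_point_norm t : `|circle_point t| = 1.
Proof.
have e : Num.conj (1 - 'i * toC t) = 1 + 'i * toC t.
  rewrite rmorphB rmorph1 rmorphM /= conjCi mulNr opprK; congr (_ + _ * _).
  by apply/eqP; rewrite eq_complex /= oppr0 !eqxx.
by rewrite normrM normfV -e norm_conjC divff // normr_eq0 circle_point_den.
Qed.

Lemma cvg_circle_point : circle_point t @[t --> 0^'] --> (1 : C).
Proof.
have it : 'i * toC t @[t --> (0 : R)^'] --> ('i * toC 0 : C).
  apply: cvgM; first exact: cvg_cst.
  by apply: cvg_toC; exact: cvg_within.
have -> : 1 = (1 + 'i * toC 0) / (1 - 'i * toC 0) :> C.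
  by rewrite (_ : toC 0 = 0) ?mulr0 ?addr0 ?subr0 ?divff ?oner_neq0.
apply: cvgM; first by apply: cvgD it; exact: cvg_cst.
apply: cvgV; first exact: circle_point_den.
by apply: cvgB it; exact: cvg_cst.
Qed.

(** For c other than 1 this is continuity at 0; the value 1 is taken only at t = 0, which is
    punctured out. *)
Lemma near_circle_point_neq (c : C) : \forall t \near (0 : R)^', circle_point t != c.
Proof.
have [->|c1] := eqVneq c 1; last first.
  have : circle_point t - c @[t --> (0 : R)^'] --> 1 - c.
    by apply: cvgB cvg_circle_point _; exact: cvg_cst.
  move/cvgr_neq0; rewrite subr_eq0 eq_sym => /(_ c1).
  by apply: filterS => t; rewrite subr_eq0.
have : \forall t \near (0 : R)^', t != 0 by exact: nbhs_dnbhs_neq.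
apply: filterS => t; apply: contraNneq => /(congr1 (fun w => w * (1 - 'i * toC t))).
rewrite divfK ?circle_point_den // mul1r => /eqP; rewrite -subr_eq0.
rewrite opprB [1 + _]addrC addrACA subrr addr0 -mulr2n -mulr_natl !mulf_eq0 pnatr_eq0 /=.
by rewrite (negPf (neq0Ci C)) (fmorph_eq0 (real_complex R)).
Qed.

Lemma near_circle_point_poly (p : {poly C}) : p != 0 ->
  \forall t \near (0 : R)^', p.[circle_point t] != 0.
Proof.
have [r ->] := closed_field_poly_normal p; rewrite scaler_eq0 => /norP[l0 _].
have : \forall t \near (0 : R)^', \prod_(z <- r) (circle_point t - z) != 0.
  elim: r => [|z r IH].
    by apply: nearW => t; rewrite big_nil oner_neq0.
  have := near_circle_point_neq z; apply: filterS2 IH => t h1 h2.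
  by rewrite big_cons mulf_neq0 // subr_eq0.
apply: filterS => t h; rewrite hornerZ mulf_neq0 // horner_prod.
by under eq_bigr do rewrite hornerXsubC.
Qed.

Lemma near_circle_point_monomials (a b : C) i j : a != 0 -> i != j ->
  \forall t \near (0 : R)^', a * circle_point t ^+ i != b * circle_point t ^+ j.
Proof.
move=> a0 ij; have := @near_circle_point_poly (a *: 'X^i - b *: 'X^j).
have -> : a *: 'X^i - b *: 'X^j != 0 :> {poly C}.
  apply: contraNneq a0 => /(congr1 (coefp i)) /=.
  by rewrite coefB !coefZ !coefXn eqxx (negPf ij) coef0 mulr1 mulr0 subr0 => ->.
move/(_ isT); apply: filterS => t.
by rewrite !hornerE subr_eq0.
Qed.

Section Rotated.
Variable m : nat.

(** The exponents are positive and distinct, so each of x_i = e, x_i = x_j and x_i x_j = 1 becomes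
    an equation between different powers of [circle_point t], which fails near t = 0. *)
Definition rotated (x : 'rV[C]_m) (t : R) : 'rV[C]_m :=
  \row_i (x 0 i * circle_point t ^+ i.+1).

Lemma rotated_norm (x : 'rV[C]_m) t : (forall i, `|x 0 i| = 1) ->
  forall i, `|rotated x t 0 i| = 1.
Proof.
by move=> x1 i; rewrite mxE normrM normrX circle_point_norm expr1n mulr1.
Qed.

Lemma cvg_rotated (x : 'rV[C]_m) i : rotated x t 0 i @[t --> (0 : R)^'] --> x 0 i.
Proof.
have : x 0 i * circle_point t ^+ i.+1 @[t --> (0 : R)^'] --> x 0 i * 1 ^+ i.+1.
  apply: cvgM; first exact: cvg_cst.
  elim: i.+1 => [|k IH]; first exact: cvg_cst.
  rewrite exprS; under eq_cvg do rewrite exprS.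
  by apply: cvgM IH; exact: cvg_circle_point.
by rewrite expr1n mulr1 => h; under eq_cvg do rewrite mxE.
Qed.

(* sqrtC picks square roots; the Weyl quotient does not depend on the choice. *)
Definition half_angles (x : 'rV[C]_m) : 'rV[C]_m := \row_i sqrtC (x 0 i).

Lemma half_anglesK (x : 'rV[C]_m) : \row_i half_angles x 0 i ^+ 2 = x.
Proof. by apply/rowP => i; rewrite !mxE sqrtCK. Qed.

Lemma near_weyl_den_neq0 (x : 'rV[C]_m) e :
  (forall i, `|x 0 i| = 1) -> e * e = 1 ->
  \forall t \near (0 : R)^', weyl_den e (half_angles (rotated x t)) != 0.
Proof.
move=> x1 ee; have x0 i : x 0 i != 0 by rewrite -normr_gt0 x1.
have h1 : \forall t \near (0 : R)^',
    forall i, x 0 i * circle_point t ^+ i.+1 != e * circle_point t ^+ 0.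
  by apply: filter_forall => i; exact: near_circle_point_monomials.
have h2 : \forall t \near (0 : R)^', forall i j : 'I_m, (j < i)%N ->
    x 0 i * circle_point t ^+ i.+1 != x 0 j * circle_point t ^+ j.+1.
  apply: filter_forall => i; apply: filter_forall => j.
  have [ji|_] := boolP (j < i)%N; last exact: nearW.
  have ij : i.+1 != j.+1 by rewrite eqSS gtn_eqF.
  have := near_circle_point_monomials (x 0 j) (x0 i) ij.
  by apply: filterS.
have h3 : \forall t \near (0 : R)^', forall i j : 'I_m,
    x 0 i * x 0 j * circle_point t ^+ (i.+1 + j.+1) != 1 * circle_point t ^+ 0.
  apply: filter_forall => i; apply: filter_forall => j.
  by apply: near_circle_point_monomials => //; rewrite mulf_neq0.
apply: filterS3 h1 h2 h3 => t h1 h2 h3.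
apply: weyl_den_neq0 => // [i|i|i j ji|i j ji]; rewrite !mxE ?sqrtCK.
- rewrite sqrtC_eq0 mulf_neq0 // expf_neq0 // -normr_gt0 circle_point_norm //.
- by have := h1 i; rewrite expr0 mulr1.
- exact: h2.
- by have := h3 i j; rewrite expr0 mulr1 exprD mulrACA.
Qed.

End Rotated.

Lemma cvg_mxtrace (T : Type) (F : set_system T) d (A : T -> 'M[C]_d) B :
  Filter F -> A t @[t --> F] --> B -> \tr (A t) @[t --> F] --> \tr B.
Proof.
move=> FF AB; apply: cvg_big => [|i _]; first exact: add_continuous.
apply: (@cvg_comp _ _ _ A (fun M : 'M[C]_d => M i i) _ _ _ AB).
exact: coord_continuous.
Qed.

(* The Weyl denominator is nonzero along the path rotated x, where the rotation
   speeds differ; continuity of the character then gives its value at g. *)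
Lemma orthogonal_characterE m (l : partition_le m)
    (o : 'M[R]_(2 * m + 1) -> C) (g : 'M[R]_(2 * m + 1)) (x : 'rV[C]_m) :
  is_orthogonal_character l o -> orthogonal_group g -> has_eigenvalues g x ->
  o g = orthogonal_schur (toC (\det g)) x (shifted_part l).
Proof.
case=> d [rho [irr otr oweyl]] gg gx.
have x1 i := has_eigenvalues_norm i gg gx.
have x0 i : x 0 i != 0 by rewrite -normr_gt0 x1.
have [G0 [A [B /= [eg GP]]]] := orthogonal_perturbation gg gx.
pose G (y : 'rV[C]_m) := G0 +
  \sum_(i < m) (complex.Re (y 0 i) *: A i + complex.Im (y 0 i) *: B i).
have ee := orthogonal_det gg.
have Gt t : [/\ orthogonal_group (G (rotated x t)),
    has_eigenvalues (G (rotated x t)) (rotated x t) &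
    \det (G (rotated x t)) = \det g] := GP _ (rotated_norm t x1).
have Gcvg : G (rotated x t) @[t --> (0 : R)^'] --> g.
  rewrite eg; apply: cvgD; first exact: cvg_cst.
  apply: cvg_big => [|i _]; first exact: add_continuous.
  apply: cvgD; apply: cvgZr_tmp.
    by apply: cvg_Re; exact: cvg_rotated.
  by apply: cvg_Im; exact: cvg_rotated.
have ocvg : o (G (rotated x t)) @[t --> (0 : R)^'] --> o g.
  rewrite otr //; under eq_cvg => t.
    have [Ot _ _] := Gt t; rewrite otr //; over.
  (* Continuity of [rho] is given only within the group, so the path must converge inside it. *)
  have Gin : G (rotated x t) @[t --> (0 : R)^'] -->
      within (@orthogonal_group R (2 * m + 1)) (nbhs g).
    move=> U Ug; apply: (@filterS _ (0 : R)^' _ _ _ _ (Gcvg _ Ug)) => t; apply.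
    by have [] := Gt t.
  apply: cvg_mxtrace; apply: cvg_comp Gin _.
  by have /subspace_continuousP := irrep_continuous irr; apply.
have scvg : orthogonal_schur (toC (\det g)) (rotated x t) (shifted_part l)
    @[t --> (0 : R)^'] --> orthogonal_schur (toC (\det g)) x (shifted_part l).
  apply: (@cvg_orthogonal_schur _ _ _ (rotated x)) => [|i]; first exact: x0.
  exact: cvg_rotated.
apply: (cvg_unique _ ocvg); first exact: norm_hausdorff.
apply: cvg_trans scvg; apply: near_eq_cvg.
apply: filterS (near_weyl_den_neq0 x1 ee) => t nz.
have [Ot Et dt] := Gt t.
rewrite (oweyl _ (half_angles (rotated x t))) ?half_anglesK ?dt //.
rewrite weyl_quotientE ?half_anglesK // => i.
by rewrite mxE sqrtC_eq0 -normr_gt0 rotated_norm.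
Qed.

End CharacterFormula.

(** * Convergence of the sum over partitions *)

Section GrowthBounds.
Variables (K : numFieldType) (t : K).
Hypotheses (t0 : 0 < t) (t1 : t < 1).
Implicit Types (f : nat -> K) (y e B : K).

Let q := (1 - t)^-1.

Let q_ge1 : 1 <= q.
Proof. by rewrite /q invf_ge1 ?subr_gt0 // gerBl ltW. Qed.

Fixpoint geoquo y f n : K :=
  if n is n1.+1 then y * geoquo y f n1 + f n else f 0%N.

(** The factorization 1 - (y + y^-1) X + X^2 = (1 - y X)(1 - y^-1 X), where [geoquo y] is division
    by 1 - y X. *)
Lemma chebquo_geoquo y f n : y != 0 ->
  chebquo (y + y^-1) f n = geoquo y (geoquo y^-1 f) n.
Proof.
move=> y0; elim/ltn_ind: n => -[|[|n]] IH //.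
  by rewrite /=; field.
rewrite chebquoSS (IH n.+1) // (IH n) //= -/(geoquo _ _).
by field.
Qed.

(** With weights t^n each weighted term is at most t times the previous one plus [B], and [B * q] is
    the fixed point of this bound. *)
Lemma geoquo_bound y f B : `|y| = 1 ->
  (forall n, `|f n| * t ^+ n <= B) -> forall n, `|geoquo y f n| * t ^+ n <= B * q.
Proof.
move=> y1 fB n.
have B0 : 0 <= B by apply: le_trans (fB 0%N); rewrite mulr_ge0 // exprn_ge0 // ltW.
elim: n => [|n IH] /=.
  by apply: le_trans (fB 0%N) _; rewrite ler_peMr.
have -> : B * q = B * q * t + B.
  by rewrite /q; field; rewrite subr_eq0 gt_eqF.
apply: (@le_trans _ _ ((`|geoquo y f n| + `|f n.+1|) * t ^+ n.+1)).
  apply: ler_wpM2r; first by rewrite exprn_ge0 // ltW.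
  by apply: le_trans (ler_normD _ _) _; rewrite normrM y1 mul1r.
rewrite mulrDl; apply: lerD => //.
by rewrite exprSr mulrA; apply: ler_wpM2r => //; apply: ltW.
Qed.

Lemma chebquo_bound y f B : `|y| = 1 ->
  (forall n, `|f n| * t ^+ n <= B) ->
  forall n, `|chebquo (y + y^-1) f n| * t ^+ n <= B * q ^+ 2.
Proof.
move=> y1 fB n; have y0 : y != 0 by rewrite -normr_gt0 y1.
rewrite chebquo_geoquo // expr2 mulrA; apply: geoquo_bound => // k.
by apply: geoquo_bound => //; rewrite normfV y1 invr1.
Qed.

Lemma weyl_series_bound e n : `|e| <= 1 -> `|weyl_series e n| * t ^+ n <= 1.
Proof.
case: n => [|[|n]] e1 /=; first by rewrite normr1 mulr1.
  by rewrite expr1 -[leRHS]mulr1 ler_pM // ltW.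
by rewrite normr0 mul0r.
Qed.

(** Each of the k + 1 Chebyshev quotients costs q^2, and each shift gains a factor t < 1. As t is
    arbitrary in (0, 1), the growth is slower than any exponential, uniformly in the nodes. *)
Lemma divdiff_bound e (v : nat -> K) m k n : `|e| <= 1 -> (k < m)%N ->
  (forall i, (i < m)%N -> exists2 y, `|y| = 1 & v i = y + y^-1) ->
  `|divdiff (weyl_series e) v k n| * t ^+ n <= (q ^+ 2) ^+ m.
Proof.
move=> e1 km vy; apply: (@le_trans _ _ ((q ^+ 2) ^+ k.+1)); last first.
  by apply: ler_weXn2l => //; rewrite exprn_ege1.
have step j : (j < m)%N ->
    (forall i, `|newton_rem (weyl_series e) v j i| * t ^+ i <= (q ^+ 2) ^+ j) ->
    forall i, `|divdiff (weyl_series e) v j i| * t ^+ i <= (q ^+ 2) ^+ j.+1.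
  move=> jm H i; have [y y1 vj] := vy _ jm.
  by rewrite /divdiff vj exprSr; apply: chebquo_bound.
apply: (step k) => //; elim: k km => [|k IH] km i.
  by rewrite expr0; exact: weyl_series_bound.
case: i => [|i].
  by rewrite /= normr0 mul0r exprn_ge0 // exprn_ge0 // (le_trans ler01).
have km' : (k < m)%N by lia.
have h := step _ km' (IH km') i.
rewrite exprSr mulrA -[leRHS]mulr1; apply: ler_pM => //; last exact: ltW.
- by rewrite mulr_ge0 // exprn_ge0 // ltW.
- exact: ltW.
Qed.

(** Every Leibniz product meets column j once, so each entry takes the weight t^(a j) of its
    column. *)
Lemma det_bound m (A : 'M[K]_m) (a : 'I_m -> nat) B :
  (forall i j, `|A i j| * t ^+ a j <= B) ->
  `|\det A| * t ^+ (\sum_(j < m) a j)%N <= (m`!)%:R * B ^+ m.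
Proof.
move=> AB; apply: (@le_trans _ _
  (\sum_(s : 'S_m) \prod_i (`|A i (s i)| * t ^+ a (s i)))).
  apply: (@le_trans _ _ ((\sum_(s : 'S_m) \prod_i `|A i (s i)|)
     * t ^+ (\sum_(j < m) a j)%N)).
    apply: ler_wpM2r; first by rewrite exprn_ge0 // ltW.
    apply: le_trans (ler_norm_sum _ _ _) _; apply: ler_sum => s _.
    by rewrite normrM normrX normrN1 expr1n mul1r normr_prod.
  rewrite mulr_suml; apply: ler_sum => s _; rewrite big_split prodrXr /=.
  have -> // : (\sum_(j < m) a j = \sum_i a (s i))%N.
  by rewrite (reindex_inj (@perm_inj _ s)).
apply: (@le_trans _ _ (\sum_(s : 'S_m) B ^+ m)).
  apply: ler_sum => s _; rewrite -[in leRHS](card_ord m) -prodr_const.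
  apply: ler_prod => i _; rewrite AB andbT.
  by rewrite mulr_ge0 // exprn_ge0 // ltW.
by rewrite sumr_const card_Sn mulr_natl.
Qed.

End GrowthBounds.

Lemma partial_sumE (I : choiceType) (V : zmodType) (F : I -> V) (J : {fset I}) :
  partial_sum F J = \sum_(i <- J) F i.
Proof. by rewrite /partial_sum (big_seq_fsetE _ _ predT F). Qed.

Lemma partial_sum_diff (I : choiceType) (V : zmodType) (F : I -> V)
    (J J' : {fset I}) : (J' `<=` J)%fset ->
  partial_sum F J - partial_sum F J' = \sum_(i <- J | i \notin J') F i.
Proof.
move=> JJ; rewrite !partial_sumE (bigID (fun i => i \in J')) /=.
rewrite -[X in X + _ - _]big_filter (perm_big J') /=; first by rewrite addrC addKr.
apply: uniq_perm; rewrite ?filter_uniq ?fset_uniq // => i.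
by rewrite mem_filter andb_idr // => /(fsubsetP JJ).
Qed.

Lemma below_shifted_part m M (l : partition_le m) j :
  l \in partitions_below m M -> (shifted_part l j < M)%N.
Proof.
rewrite inE /= => /mapP[g]; rewrite mem_enum => dg ->.
by rewrite shifted_partition_of.
Qed.

Lemma notin_below_psize m N (l : partition_le m) :
  l \notin partitions_below m (N + m) -> (N < psize l)%N.
Proof.
apply: contraR; rewrite -leqNgt => lN; apply: partitions_belowP => j.
have lj : (tnth (val l) j <= psize l)%N by rewrite /psize (bigD1 j) //= leq_addr.
by rewrite /shifted_part; have := ltn_ord j; lia.
Qed.

Lemma partitions_below_subset m M M' : (M <= M')%N ->
  (partitions_below m M `<=` partitions_below m M')%fset.
Proof.
move=> MM; apply/fsubsetP => l lM; apply: partitions_belowP => j.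
exact: leq_trans (below_shifted_part j lM) MM.
Qed.

(** A partition outside [partitions_below m (N + m)] has size above N, so t^(2|l|) is at most t^N
    t^|l|, and [sum_psize_le] sums the last factor. *)
Lemma partial_sum_tail (K : numFieldType) (t B : K) m (F : partition_le m -> K) N J :
  0 < t -> t < 1 -> (forall l, `|F l| <= B * t ^+ (2 * psize l)) ->
  (partitions_below m (N + m) `<=` J)%fset ->
  `|partial_sum F J - partial_sum F (partitions_below m (N + m))| <=
  B * (1 - t)^-1 ^+ m * t ^+ N.
Proof.
move=> t0 t1 FB NJ; have t0' := ltW t0.
have B0 : 0 <= B.
  (* Any partition would do: a single instance of the bound forces [B] to be nonnegative. *)
  have := FB (partition_of (nseq_tuple m (ord0 : 'I_1))).
  move/(le_trans (normr_ge0 _)).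
  by rewrite pmulr_lge0 // exprn_gt0.
rewrite partial_sum_diff //; apply: le_trans (ler_norm_sum _ _ _) _.
apply: (@le_trans _ _ (\sum_(l <- J | l \notin partitions_below m (N + m))
    B * t ^+ N * t ^+ psize l)).
  apply: ler_sum => l /notin_below_psize Nl; apply: le_trans (FB l) _.
  rewrite -mulrA -exprD; apply: ler_wpM2l => //.
  by apply: ler_wiXn2l => //; [exact: ltW | lia].
apply: (@le_trans _ _ (\sum_(l <- J) B * t ^+ N * t ^+ psize l)).
  rewrite big_mkcond /=; apply: ler_sum => l _; case: ifP => // _.
  by rewrite !mulr_ge0 // exprn_ge0.
rewrite -mulr_sumr [leRHS]mulrAC; apply: ler_wpM2l.
  by rewrite mulr_ge0 // exprn_ge0.
rewrite (big_seq_fsetE _ _ predT) /=; exact: sum_psize_le.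
Qed.

(** * Geometric rates of convergence for complex sequences and sums over partitions *)

Section ComplexLimits.
Variable R : realType.
Notation C := (Cplx R).

Section Geometric.
Variables (t : R) (b : R).
Hypotheses (t0 : 0 < t) (t1 : t < 1).

Lemma near_geometric_lt (e : C) : 0 < e ->
  \forall n \near \oo, toC b * toC t ^+ n < e.
Proof.
move=> /toC_pos[r r0 ->].
have : b * t ^+ n @[n --> \oo] --> b * 0.
  apply: cvgM; first exact: cvg_cst.
  by apply: cvg_expr; rewrite ger0_norm ?ltW.
rewrite mulr0 => /cvgr0_norm_lt /(_ _ r0); apply: filterS => n h.
rewrite -(rmorphXn (real_complex R)) -(rmorphM (real_complex R)) ltcR.
exact: le_lt_trans (ler_norm _) h.
Qed.

Lemma cvg_geometric0 (s : nat -> C) :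
  (forall n, `|s n| <= toC b * toC t ^+ n) -> s n @[n --> \oo] --> (0 : C).
Proof.
move=> sb; apply/cvgr0Pnorm_lt => e /near_geometric_lt.
by apply: filterS => n; apply: le_lt_trans.
Qed.

Lemma geometric_cauchy_cvg_real (s : nat -> R) :
  (forall N M, (N <= M)%N -> `|s N - s M| <= b * t ^+ N) ->
  exists l : R, s n @[n --> \oo] --> l.
Proof.
move=> sb; suff : cvg (s n @[n --> \oo]) by move=> h; exists (lim (s n @[n --> \oo])).
apply/cauchy_cvgP/cauchy_exP => e e0.
have [N _ HN] : \forall n \near \oo, toC b * toC t ^+ n < toC e.
  by apply: near_geometric_lt; rewrite (ltr_toC 0).
exists (s N); exists N => // M /= NM.
apply: le_lt_trans (sb _ _ NM) _; have := HN N (leqnn N).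
by rewrite -(rmorphXn (real_complex R)) -(rmorphM (real_complex R)) ltcR.
Qed.

Lemma geometric_cauchy_cvg (s : nat -> C) :
  (forall N M, (N <= M)%N -> `|s M - s N| <= toC b * toC t ^+ N) ->
  exists2 l : C, s n @[n --> \oo] --> l &
    forall N, `|l - s N| <= toC b * toC t ^+ N.
Proof.
move=> sb.
have Re_le N M : (N <= M)%N ->
    `|complex.Re (s N) - complex.Re (s M)| <= b * t ^+ N.
  move=> NM; rewrite distrC -raddfB -lecR; apply: le_trans (normc_ge_Re _) _.
  by rewrite rmorphM rmorphXn; exact: sb.
have Im_le N M : (N <= M)%N ->
    `|complex.Im (s N) - complex.Im (s M)| <= b * t ^+ N.
  move=> NM; rewrite distrC -raddfB -lecR /=.
  have -> : complex.Im (s M - s N) = complex.Re (- 'i%C * (s M - s N)).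
    by case: (s M - s N) => x y /=; ring.
  apply: le_trans (normc_ge_Re _) _.
  rewrite normrM normrN; have -> : `|'i%C : R[i]| = 1.
    by rewrite normc_def /= expr0n expr1n add0r sqrtr1.
  by rewrite mul1r rmorphM rmorphXn; exact: sb.
have [x sx] := geometric_cauchy_cvg_real Re_le.
have [y sy] := geometric_cauchy_cvg_real Im_le.
have sl : s n @[n --> \oo] --> (toC x + 'i%C * toC y : C).
  have e n : s n = toC (complex.Re (s n)) + 'i%C * toC (complex.Im (s n)).
    by rewrite {1}[s n]complexE.
  under eq_cvg do rewrite e.
  apply: cvgD; first exact: cvg_toC.
  by apply: cvgM (cvg_toC _ sy); exact: cvg_cst.
exists (toC x + 'i%C * toC y) => // N.
apply/ler_addgt0Pl => e e0.
have /cvgrPdist_le/(_ _ e0)[M _ HM] := sl.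
have := HM (maxn N M) (leq_maxr _ _) => h.
rewrite -[X in `|X|](subrKA (s (maxn N M))).
apply: le_trans (ler_normD _ _) _; apply: lerD => //.
by apply: sb; exact: leq_maxl.
Qed.

End Geometric.

(** The tail bound makes the sums over [partitions_below] Cauchy and controls every finite set
    containing one of these, so the net has the same limit. The rate involves only [m], [t] and [B],
    hence is uniform wherever [B] is. *)
Lemma partition_has_sum m (t B : R) (F : partition_le m -> C) :
  0 < t -> t < 1 -> (forall l, `|F l| <= toC B * toC t ^+ (2 * psize l)) ->
  exists S : C, [/\ has_sum F S,
    partial_sum F (partitions_below m (N + m)) @[N --> \oo] --> S &
    forall N, `|S - partial_sum F (partitions_below m (N + m))| <=
      toC (B * (1 - t)^-1 ^+ m) * toC t ^+ N].
Proof.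
move=> t0 t1 FB.
have tail N J : (partitions_below m (N + m) `<=` J)%fset ->
    `|partial_sum F J - partial_sum F (partitions_below m (N + m))| <=
    toC (B * (1 - t)^-1 ^+ m) * toC t ^+ N.
  move=> NJ; have := @partial_sum_tail _ (toC t) (toC B) m F N J.
  rewrite (ltr_toC 0) (ltr_toC _ 1) => /(_ t0 t1 FB NJ).
  have -> // : toC (B * (1 - t)^-1 ^+ m) = toC B * (1 - toC t)^-1 ^+ m.
  by rewrite /toC rmorphM rmorphXn fmorphV rmorphB rmorph1.
have [|S cS HS] := geometric_cauchy_cvg t0 t1
    (s := fun N => partial_sum F (partitions_below m (N + m)))
    (b := B * (1 - t)^-1 ^+ m).
  move=> N M NM; apply: tail; apply: partitions_below_subset.
  by rewrite leq_add2r.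
have FF := @totally_filter (partition_le m).
exists S; split=> //; apply/cvgrPdist_le => e e0.
have e20 : 0 < e / 2%:R by rewrite divr_gt0.
have [N _ HN] := near_geometric_lt (B * (1 - t)^-1 ^+ m) t0 t1 e20.
have {}HN := ltW (HN N (leqnn N)).
exists (partitions_below m (N + m)) => // J /= NJ.
rewrite -[X in `|X|](subrKA (partial_sum F (partitions_below m (N + m)))).
apply: le_trans (ler_normD _ _) _; rewrite [leRHS]splitr; apply: lerD.
  exact: le_trans (HS N) HN.
by rewrite distrC; apply: le_trans (tail N J NJ) HN.
Qed.

End ComplexLimits.

(** * Limits of the matrix entries *)

Section KernelLimit.
Variable R : realType.
Notation C := (Cplx R).
Variable t : R.
Hypotheses (t0 : 0 < t) (t1 : t < 1).
Let T : C := toC t.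
(** A fourth power leaves two powers of [T] to absorb the growth of two polynomials and two for
    decay. *)
Let Z : C := T ^+ 4.

Let T0 : 0 < T. Proof. by rewrite (ltr_toC 0). Qed.
Let T1 : T < 1. Proof. by rewrite (ltr_toC _ 1). Qed.

Lemma kernel_denE (x y : C) : x != 0 -> y != 0 ->
  kernel_den Z (x + x^-1) (y + y^-1) =
  (1 - Z * x * y) * (1 - Z * x^-1 * y) * (1 - Z * x * y^-1) * (1 - Z * x^-1 * y^-1).
Proof. by move=> x0 y0; rewrite /kernel_den; field; rewrite x0 y0. Qed.

Lemma kernel_den_neq0 (x y : C) : `|x| = 1 -> `|y| = 1 ->
  kernel_den Z (x + x^-1) (y + y^-1) != 0.
Proof.
move=> x1 y1.
have x0 : x != 0 by rewrite -normr_gt0 x1.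
have y0 : y != 0 by rewrite -normr_gt0 y1.
have aux (a b : C) : `|a| = 1 -> `|b| = 1 -> 1 - Z * a * b != 0.
  move=> a1 b1; rewrite subr_eq0; apply/eqP => /(congr1 Num.norm) /eqP.
  rewrite normr1 normrM b1 mulr1 normrM a1 mulr1 /Z normrX gtr0_norm // eq_sym lt_eqF //.
  by rewrite exprn_ilt1 // ltW.
by rewrite kernel_denE // !mulf_neq0 // aux // normfV ?x1 ?y1 invr1.
Qed.

(** In [kernel_partial_sum] the remainder is a fixed combination of the terms Z^n c(n) for n = N,
    ..., N + 3, which tend to 0. *)
Lemma cvg_kernel (e d x y : C) : e * e = 1 -> d * d = 1 -> `|x| = 1 -> `|y| = 1 ->
  let u := x + x^-1 in let v := y + y^-1 in
  \sum_(k < N) Z ^+ k * (weyl_poly e u k * weyl_poly d v k) @[N --> \oo] -->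
  kernel_num Z e d u v / kernel_den Z u v.
Proof.
move=> ee dd x1 y1 u v; pose c n := weyl_poly e u n * weyl_poly d v n.
have norm1 (a : C) : a * a = 1 -> `|a| <= 1.
  by move/eqP; rewrite -expr2 sqrf_eq1 => /orP[] /eqP ->; rewrite ?normrN normr1.
pose q := (1 - t)^-1 : R.
have cZ : Z ^+ n * c n @[n --> \oo] --> (0 : C).
  apply: (@cvg_geometric0 R (t ^+ 2) (q ^+ 2 * q ^+ 2)).
  - by rewrite exprn_gt0.
  - by rewrite exprn_ilt1 // ltW.
  move=> n; have h1 := chebquo_bound T0 T1 x1 (fun n => weyl_series_bound T0 T1 n (norm1 e ee)) n.
  have h2 := chebquo_bound T0 T1 y1 (fun n => weyl_series_bound T0 T1 n (norm1 d dd)) n.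
  rewrite /Z normrM normrX normrX gtr0_norm // normrM.
  rewrite mul1r in h1; rewrite mul1r in h2.
  have -> : toC (q ^+ 2 * q ^+ 2) = (1 - T)^-1 ^+ 2 * (1 - T)^-1 ^+ 2.
    by rewrite /toC rmorphM rmorphXn /q fmorphV rmorphB rmorph1.
  rewrite [toC (t ^+ 2)](rmorphXn (real_complex R)) /= -[(t%:C)%C]/T.
  have h := ler_pM (mulr_ge0 (normr_ge0 _) (exprn_ge0 n (ltW T0)))
    (mulr_ge0 (normr_ge0 _) (exprn_ge0 n (ltW T0))) h1 h2.
  have {}h := ler_wpM2r (exprn_ge0 (2 * n) (ltW T0)) h.
  have E2 : T ^+ 2 ^+ n = T ^+ (2 * n) by rewrite exprM.
  rewrite E2; apply: le_trans h.
  rewrite le_eqVlt; apply/orP; left; apply/eqP.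
  rewrite /Z -exprM (_ : 4 * n = n + n + 2 * n)%N; last by lia.
  by rewrite !exprD; ring.
have cZk k : Z ^+ (n + k) * c (n + k)%N @[n --> \oo] --> (0 : C).
  have h := @cvg_comp _ _ _ (fun n => (n + k)%N) (fun n => Z ^+ n * c n) _ _ _ (cvg_addnr k) cZ.
  exact: h.
have den0 : kernel_den Z u v != 0 by exact: kernel_den_neq0.
have E N : \sum_(k < N) Z ^+ k * (weyl_poly e u k * weyl_poly d v k) =
  (kernel_den Z u v)^-1 * (kernel_num Z e d u v -
    ((1 - Z * u * v + Z ^+ 2 * (u ^+ 2 + v ^+ 2 - 2%:R) - Z ^+ 3 * u * v)
         * (Z ^+ (N + 0) * c (N + 0)%N)
     + (1 - Z * u * v + Z ^+ 2 * (u ^+ 2 + v ^+ 2 - 2%:R)) * (Z ^+ (N + 1) * c (N + 1)%N)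
     + (1 - Z * u * v) * (Z ^+ (N + 2) * c (N + 2)%N)
     + Z ^+ (N + 3) * c (N + 3)%N)).
  apply: (mulfI den0); rewrite mulrA divff // mul1r kernel_partial_sum //.
  rewrite !addnS addn0 -/(c N) -/(c N.+1) -/(c N.+2) -/(c N.+3).
  congr (_ - _); rewrite !exprS; ring.
under eq_cvg do rewrite E.
rewrite mulrC -[X in _ * X]subr0; apply: cvgM; first exact: cvg_cst.
apply: cvgB; first exact: cvg_cst.
rewrite (_ : 0 = (1 - Z * u * v + Z ^+ 2 * (u ^+ 2 + v ^+ 2 - 2%:R) - Z ^+ 3 * u * v) * 0
  + (1 - Z * u * v + Z ^+ 2 * (u ^+ 2 + v ^+ 2 - 2%:R)) * 0
  + (1 - Z * u * v) * 0 + 0); last by rewrite !mulr0 !addr0.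
by apply: cvgD (cZk _); apply: cvgD; [apply: cvgD|];
  apply: cvgM (cZk _); exact: cvg_cst.
Qed.

End KernelLimit.

Lemma norm_lt_third (K : numFieldType) (a b c d eps : K) :
  `|a - b| < eps / 3%:R -> `|b - c| < eps / 3%:R -> `|d - c| < eps / 3%:R ->
  `|a - d| < eps.
Proof.
move=> ab bc cd; have -> : a - d = (a - b) + (b - c) - (d - c) by ring.
have -> : eps = eps / 3%:R + eps / 3%:R + eps / 3%:R by field.
apply: le_lt_trans (ler_normB _ _) _; apply: ltrD => //.
by apply: le_lt_trans (ler_normD _ _) _; apply: ltrD.
Qed.

(** * The Cauchy identity on the unit torus *)

Section CauchyIdentity.
Variable R : realType.
Notation C := (Cplx R).
Variables (m : nat) (t : R) (e d : C).
Hypotheses (t0 : 0 < t) (t1 : t < 1) (ee : e * e = 1) (dd : d * d = 1).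
Let T : C := toC t.
Let T0 : 0 < T. Proof. by rewrite (ltr_toC 0). Qed.
Let T1 : T < 1. Proof. by rewrite (ltr_toC _ 1). Qed.
Implicit Types (x y : 'rV[C]_m) (l : partition_le m) (p : 'rV[C]_m * 'rV[C]_m).

(* T ^+ 4 plays the role of z: each of the two characters grows at most like
   T ^- psize l, which leaves a summable factor T ^+ (2 * psize l). *)
Definition cauchy_term p l : C := (T ^+ 4) ^+ psize l *
  orthogonal_schur e p.1 (shifted_part l) * orthogonal_schur d p.2 (shifted_part l).

Let q : R := (1 - t)^-1.
(** [det_bound] with entries bounded by [divdiff_bound]; the denominator is the weight of the
    staircase. *)
Definition schur_bound : R := (m`!)%:R * ((q ^+ 2) ^+ m) ^+ m / t ^+ 'C(m, 2).

Lemma orthogonal_schur_bound (c : C) x l : c * c = 1 -> (forall i, `|x 0 i| = 1) ->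
  `|orthogonal_schur c x (shifted_part l)| * T ^+ psize l <= toC schur_bound.
Proof.
move=> cc x1.
have c1 : `|c| <= 1.
  by move: cc => /eqP; rewrite -expr2 sqrf_eq1 => /orP[] /eqP ->; rewrite ?normrN normr1.
have -> : toC schur_bound =
    (m`!)%:R * (((1 - T)^-1 ^+ 2) ^+ m) ^+ m / T ^+ 'C(m, 2).
  rewrite /toC /schur_bound !rmorphM fmorphV !rmorphXn rmorph_nat.
  by rewrite /q fmorphV rmorphB rmorph1.
rewrite ler_pdivlMr ?exprn_gt0 // -mulrA -exprD -sum_shifted_part.
rewrite /orthogonal_schur normrM normr_sign mul1r.
apply: det_bound => // i j; rewrite mxE.
apply: (divdiff_bound T0 T1 _ c1 (ltn_ord i)) => k km.
by exists (x 0 (Ordinal km)) => //; rewrite -trace_seq_ord.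
Qed.

Lemma cauchy_term_bound p l :
  (forall i, `|p.1 0 i| = 1) -> (forall i, `|p.2 0 i| = 1) ->
  `|cauchy_term p l| <= toC (schur_bound ^+ 2) * T ^+ (2 * psize l).
Proof.
move=> x1 y1; have hx := orthogonal_schur_bound l ee x1.
have hy := orthogonal_schur_bound l dd y1.
have h := ler_pM (mulr_ge0 (normr_ge0 _) (exprn_ge0 (psize l) (ltW T0)))
    (mulr_ge0 (normr_ge0 _) (exprn_ge0 (psize l) (ltW T0))) hx hy.
have {}h := ler_wpM2r (exprn_ge0 (2 * psize l) (ltW T0)) h.
have -> : toC (schur_bound ^+ 2) = toC schur_bound * toC schur_bound.
  by rewrite /toC expr2 rmorphM.
apply: le_trans h; rewrite le_eqVlt; apply/orP; left; apply/eqP.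
rewrite /cauchy_term normrM normrM normrX normrX gtr0_norm // -exprM.
rewrite (_ : 4 * psize l = psize l + psize l + 2 * psize l)%N; last by lia.
rewrite exprD exprD.
by rewrite mulrACA -[RHS]mulrA [RHS]mulrC mulrA.
Qed.

(** Cauchy-Binet, with [det_chebquo] taking a Vandermonde product out of both minors. The staircase
    accounts for the power 'C(m, 2), and the two reversal signs cancel. *)
Lemma cauchy_partial_sum p M :
  let u := trace_seq p.1 in let v := trace_seq p.2 in
  \det (\matrix_(i < m, j < m)
    \sum_(k < M) (T ^+ 4) ^+ k * (weyl_poly e (u i) k * weyl_poly d (v j) k)) =
  (T ^+ 4) ^+ 'C(m, 2) *
  ((\prod_(i < m) \prod_(k < i) (u i - u k)) *
   (\prod_(i < m) \prod_(k < i) (v i - v k))) *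
  partial_sum (cauchy_term p) (partitions_below m M).
Proof.
move=> u v; rewrite (cauchy_binet_series M (T ^+ 4)
  (fun i : 'I_m => weyl_poly e (u i)) (fun j : 'I_m => weyl_poly d (v j))).
rewrite partial_sum_below mulr_sumr; apply: eq_bigr => g dg.
rewrite /weyl_poly !det_chebquo psize_partition_of // /cauchy_term /orthogonal_schur.
have E (w : C) f : \det (\matrix_(i < m, j < m)
      divdiff (weyl_series w) f i (shifted_part (partition_of g) j)) =
    \det (\matrix_(i < m, j < m) divdiff (weyl_series w) f i (tnth g j)).
  by congr (\det _); apply/matrixP => i j; rewrite !mxE shifted_partition_of.
rewrite !E exprD -/u -/v.
set A := \det _; set B := \det _.
set r := reversal_sign _ _.
have rr : r * r = 1 by exact: reversal_sign_sqr.
set U := \prod_(i < m) _; set V := \prod_(i < m) _.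
set z1 := _ ^+ psize _; set z2 := _ ^+ 'C(m, 2).
transitivity (z1 * z2 * (U * A * (V * B)) * (r * r)); first by rewrite rr mulr1.
by ring.
Qed.

Lemma prod_swap_lt (F : 'I_m -> 'I_m -> C) :
  \prod_(i < m) \prod_(j < m | (i < j)%N) F i j =
  \prod_(i < m) \prod_(j < m | (j < i)%N) F j i.
Proof. by rewrite (exchange_big_dep xpredT). Qed.

Lemma vandermonde_swap x :
  let u := trace_seq x in
  \prod_(i < m) \prod_(k < i) (u i - u k) = (-1) ^+ 'C(m, 2) *
  \prod_(i < m) \prod_(j < m | (i < j)%N)
    (x 0 i + (x 0 i)^-1 - (x 0 j + (x 0 j)^-1)).
Proof.
move=> u; rewrite prod_swap_lt -bin2_sum big_mkord -prodrXr -big_split /=.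
apply: eq_bigr => i _.
rewrite (big_ord_widen _ (fun k => u i - u k) (ltnW (ltn_ord i))).
rewrite -[i in (-1) ^+ i](card_ord i) -prodr_const.
rewrite (big_ord_widen _ (fun k => -1) (ltnW (ltn_ord i))) -big_split /=.
by apply: eq_bigr => j _; rewrite mulN1r opprB /u !trace_seq_ord.
Qed.

(** Reordering the differences gives the sign (-1)^'C(m, 2) once for x and once for y, so it
    cancels. *)
Lemma cauchy_rhsE p : regular_pairs p ->
  let u := trace_seq p.1 in let v := trace_seq p.2 in
  cauchy_rhs (T ^+ 4) e d (e * d) p.1 p.2 =
  ((T ^+ 4) ^+ 'C(m, 2) *
   ((\prod_(i < m) \prod_(k < i) (u i - u k)) *
    (\prod_(i < m) \prod_(k < i) (v i - v k))))^-1 *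
  \det (\matrix_(i < m, j < m)
    (kernel_num (T ^+ 4) e d (u i) (v j) / kernel_den (T ^+ 4) (u i) (v j))).
Proof.
case: p => x y [/= x1 y1 rx ry]; rewrite /cauchy_rhs !vandermonde_swap.
set U := \prod_(i < m) _; set V := \prod_(i < m) _.
set w := _ ^+ 'C(m, 2); set s := _ ^+ 'C(m, 2).
have ss : s * s = 1 by rewrite -exprD addnn -mul2n exprM sqrrN !expr1n.
have -> : w * (s * V * (s * U)) = w * U * V.
  by transitivity (w * U * V * (s * s)); [ring | rewrite ss mulr1].
rewrite [RHS]mulrC; congr (_ / _).
rewrite -detZ; congr (\det _); apply/matrixP => i j; rewrite !mxE.
have x0 : x 0 i != 0 by rewrite -normr_gt0 x1.
have y0 : y 0 j != 0 by rewrite -normr_gt0 y1.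
by rewrite !trace_seq_ord kernel_denE // /kernel_num -!mulrA.
Qed.

Lemma regular_vandermonde x : regular x ->
  \prod_(i < m) \prod_(k < i) (trace_seq x i - trace_seq x k) != 0.
Proof.
move=> rx; rewrite vandermonde_swap mulf_neq0 ?expf_neq0 ?oppr_eq0 ?oner_neq0 //.
apply/prodf_neq0 => i _; apply/prodf_neq0 => j ij; rewrite subr_eq0; exact: rx.
Qed.

Lemma cvg_cauchy_rhs p : regular_pairs p ->
  partial_sum (cauchy_term p) (partitions_below m (N + m)) @[N --> \oo] -->
  cauchy_rhs (T ^+ 4) e d (e * d) p.1 p.2.
Proof.
move=> rp; have [x1 y1 rx ry] := rp; rewrite cauchy_rhsE //.
set D := _ * (_ * _); have D0 : D != 0.
  by rewrite mulf_neq0 ?mulf_neq0 ?expf_neq0 ?regular_vandermonde // gt_eqF.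
have E N : partial_sum (cauchy_term p) (partitions_below m (N + m)) = D^-1 *
  \det (\matrix_(i < m, j < m) \sum_(k < N + m) (T ^+ 4) ^+ k *
     (weyl_poly e (trace_seq p.1 i) k * weyl_poly d (trace_seq p.2 j) k)).
  by rewrite cauchy_partial_sum mulKf.
under eq_cvg do rewrite E.
apply: cvgM; first exact: cvg_cst.
apply: cvg_det => i j; rewrite mxE; under eq_cvg do rewrite mxE.
rewrite !trace_seq_ord.
have h := cvg_kernel t0 t1 ee dd (x1 i) (y1 j).
exact: (@cvg_comp _ _ _ (fun N => (N + m)%N) _ _ _ _ (cvg_addnr m) h).
Qed.

Section Continuity.
Variables (p0 : 'rV[C]_m * 'rV[C]_m) (F : set_system ('rV[C]_m * 'rV[C]_m)).
Hypotheses (FF : Filter F) (Fp0 : F --> p0).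
Hypotheses (x1 : forall i, `|p0.1 0 i| = 1) (y1 : forall i, `|p0.2 0 i| = 1).

Lemma cvg_cauchy_partial_sum N :
  partial_sum (cauchy_term p) (partitions_below m N) @[p --> F] -->
  partial_sum (cauchy_term p0) (partitions_below m N).
Proof.
rewrite partial_sum_below; under eq_fun do rewrite partial_sum_below.
apply: cvg_big => [|g _]; first exact: add_continuous.
have cx (i : 'I_m) : (p : 'rV[C]_m * 'rV[C]_m).1 0 i @[p --> F] --> p0.1 0 i.
  apply: (@cvg_comp _ _ _ (fun p : 'rV[C]_m * 'rV[C]_m => p.1)
    (fun M : 'rV[C]_m => M 0 i) F (nbhs p0.1)).
    by apply: cvg_comp Fp0 _; exact: cvg_fst.
  exact: coord_continuous.
have cy (i : 'I_m) : (p : 'rV[C]_m * 'rV[C]_m).2 0 i @[p --> F] --> p0.2 0 i.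
  apply: (@cvg_comp _ _ _ (fun p : 'rV[C]_m * 'rV[C]_m => p.2)
    (fun M : 'rV[C]_m => M 0 i) F (nbhs p0.2)).
    by apply: cvg_comp Fp0 _; exact: cvg_snd.
  exact: coord_continuous.
apply: cvgM; first apply: cvgM; first exact: cvg_cst.
  apply: (cvg_orthogonal_schur (x := fun p => p.1)) => // i.
  by rewrite -normr_gt0 x1.
apply: (cvg_orthogonal_schur (x := fun p => p.2)) => // i.
by rewrite -normr_gt0 y1.
Qed.

End Continuity.

(** The finite sums are continuous and converge uniformly on the torus, while on regular pairs the
    full sum is the right-hand side. A three-epsilon estimate then gives the limit at [p0]. *)
Lemma cauchy_identity p0 :
  (forall i, `|p0.1 0 i| = 1) -> (forall i, `|p0.2 0 i| = 1) ->
  (regular p0.1 -> regular p0.2 ->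
   has_sum (cauchy_term p0) (cauchy_rhs (T ^+ 4) e d (e * d) p0.1 p0.2)) /\
  (exists S : C, has_sum (cauchy_term p0) S /\
   cauchy_rhs (T ^+ 4) e d (e * d) p.1 p.2
     @[p --> within (@regular_pairs R m) (nbhs p0)] --> S).
Proof.
move=> x1 y1.
have sums p (px1 : forall i, `|p.1 0 i| = 1) (py1 : forall i, `|p.2 0 i| = 1) :=
  partition_has_sum t0 t1 (fun l => cauchy_term_bound l px1 py1).
have [S [FS cS rS]] := sums _ x1 y1.
have S_rhs p S' : regular_pairs p ->
    partial_sum (cauchy_term p) (partitions_below m (N + m)) @[N --> \oo] --> S' ->
    S' = cauchy_rhs (T ^+ 4) e d (e * d) p.1 p.2.
  move=> rp cS'; apply: (cvg_unique _ cS'); first exact: norm_hausdorff.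
  exact: cvg_cauchy_rhs.
split; first by move=> rx ry; rewrite -(S_rhs p0 S).
exists S; split=> //; apply/cvgrPdist_lt => eps eps0.
have eps30 : 0 < eps / 3%:R by rewrite divr_gt0.
have [N _ HN] := near_geometric_lt (schur_bound ^+ 2 * (1 - t)^-1 ^+ m) t0 t1 eps30.
have {}HN := HN N (leqnn N).
have WF : Filter (within (@regular_pairs R m) (nbhs p0)) by exact: within_filter.
have WW : within (@regular_pairs R m) (nbhs p0) --> p0 by exact: cvg_within.
have /cvgrPdist_lt/(_ _ eps30) := cvg_cauchy_partial_sum (N := (N + m)%N) WF WW x1 y1.
apply: filterS2 (withinT _ _) => p rp h.
have [px1 py1 _ _] := rp.
have [S' [_ cS' rS']] := sums _ px1 py1.
rewrite -(S_rhs p S') //.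
apply: norm_lt_third h _; first exact: le_lt_trans (rS N) HN.
exact: le_lt_trans (rS' N) HN.
Qed.

End CauchyIdentity.

(* The identity holds as displayed whenever the denominator of the right-hand
   side is nonzero. In general the right-hand side has a removable singularity,
   and the sum is the value of its continuous extension. *)
Theorem corollary3p3 (R : realType) (m : nat) (hm : (1 <= m)%N)
  (o : partition_le m -> 'M[R]_(2 * m + 1) -> Cplx R)
  (ho : forall l : partition_le m, is_orthogonal_character l (o l))
  (g h : 'M[R]_(2 * m + 1))
  (hg : orthogonal_group g) (hh : orthogonal_group h)
  (x y : 'rV[Cplx R]_m)
  (hx : has_eigenvalues g x) (hy : has_eigenvalues h y)
  (z : R) (hz0 : 0 < z) (hz1 : z < 1) :
  let rhs := @cauchy_rhs R m (toC z) (toC (\det g)) (toC (\det h))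
               (toC (\det (g *m h))) in
  let term := fun l : partition_le m => toC z ^+ psize l * o l g * o l h in
  (regular x -> regular y -> has_sum term (rhs x y)) /\
  (exists S : Cplx R, has_sum term S /\
     rhs p.1 p.2 @[p --> within (@regular_pairs R m) (nbhs (x, y))] --> S).
Proof.
(* The fourth root of z, as [cauchy_term] is stated with [T ^+ 4] for z. *)
move=> rhs term; pose t := Num.sqrt (Num.sqrt z).
have t0 : 0 < t by rewrite !sqrtr_gt0.
have tz : t ^+ 4 = z by rewrite (exprM t 2 2) !sqr_sqrtr ?sqrtr_ge0 ?ltW.
have t1 : t < 1 by rewrite -(@expr_lt1 _ 4 t) ?tz // ltW.
have tZ : toC t ^+ 4 = toC z by rewrite -tz [RHS](rmorphXn (real_complex R)).
have ee := orthogonal_det hg; have dd := orthogonal_det hh.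
have termE : term = cauchy_term t (toC (\det g)) (toC (\det h)) (x, y).
  apply/funext => l; rewrite /term /cauchy_term tZ.
  by rewrite (orthogonal_characterE (ho l) hg hx) (orthogonal_characterE (ho l) hh hy).
rewrite termE /rhs det_mulmx [toC (_ * _)](rmorphM (real_complex R)) -tZ.
have x1 i := has_eigenvalues_norm i hg hx.
have y1 i := has_eigenvalues_norm i hh hy.
exact: (cauchy_identity t0 t1 ee dd (p0 := (x, y)) x1 y1).
Qed.
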